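(* Let $n\ge 3$, let $\mathcal{P}$ be a finite chiral $n$-polytope of type $\{p_{1},\ldots,p_{n-1}\}$, let $\mathcal{Q}$ be a finite directly regular $n$-polytope of type $\{q_{1},\ldots,q_{n-1}\}$, and suppose $\gcd(p_j,q_j)=1$ for each $j=1,\ldots,n-1$. Then the mix $\Gamma(\mathcal{P})\diamondsuit\Gamma^{+}(\mathcal{Q})$ has the intersection property, so $\mathcal{P}\diamondsuit\mathcal{Q}$ is a chiral or directly regular $n$-polytope of type $\{p_{1}q_{1},\ldots,p_{n-1}q_{n-1}\}$ whose (rotation) group is $\Gamma(\mathcal{P})\times\Gamma^{+}(\mathcal{Q})$. Moreover, if $\mathcal{P}$ is totally chiral and $\Gamma(\mathcal{P})\times\Gamma^{+}(\mathcal{Q})$ has no subgroup which has a quotient isomorphic to $\Gamma(\mathcal{P})\times\Gamma(\mathcal{P})$ (in particular, if $|\Gamma(\mathcal{P})|$ does not divide $|\Gamma^{+}(\mathcal{Q})|$), then $\mathcal{P}\diamondsuit\mathcal{Q}$ is chiral.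
   Context: An abstract $n$-polytope is a ranked poset (ranks $-1,\dots,n$) with a least and a greatest face, all flags of size $n+2$, strongly flag-connected, satisfying the diamond condition; $\Gamma(\mathcal P)$ is its automorphism group. $\mathcal P$ is regular if $\Gamma(\mathcal P)$ is flag-transitive; chiral if $\Gamma(\mathcal P)$ has two flag orbits with adjacent flags in distinct orbits. For regular $\mathcal P$ with generating involutions $\rho_0,\dots,\rho_{n-1}$ (base flag to $i$-adjacent flag), $\Gamma^+(\mathcal P)=\langle\sigma_1,\dots,\sigma_{n-1}\rangle$ with $\sigma_i=\rho_{i-1}\rho_i$; $\mathcal P$ is directly regular if $[\Gamma(\mathcal P):\Gamma^+(\mathcal P)]=2$. For chiral $\mathcal P$, $\Gamma(\mathcal P)$ is generated by the distinguished rotations $\sigma_1,\dots,\sigma_{n-1}$ with respect to a base flag, and $\Gamma^+(\mathcal P):=\Gamma(\mathcal P)$. The type is $\{p_1,\dots,p_{n-1}\}$ with $p_i$ the order of $\sigma_i$. Intersection property for $\Gamma=\langle\sigma_1,\dots,\sigma_{n-1}\rangle$: set $\kappa_{i,j}=\sigma_i\sigma_{i+1}\cdots\sigma_j$ ($1\le i\le j\le n-1$), $\kappa_{0,i}=\kappa_{i,n}=\epsilon$, and for $I\subseteq\{-1,0,\dots,n\}$ let $\Gamma^I=\langle\kappa_{i,j}: i\le j,\ i-1\in I,\ j\in I\rangle$; require $\Gamma^I\cap\Gamma^J=\Gamma^{I\cap J}$ for all $I,J$. A group generated by $\sigma_1,\dots,\sigma_{n-1}$ satisfying $\sigma_i^{p_i}=(\sigma_i\cdots\sigma_j)^2=\epsilon$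 ($i<j$) and the intersection property is the group of a chiral $n$-polytope or the rotation group of a directly regular $n$-polytope with these distinguished generators. Mix: with $\Gamma^+(\mathcal P)=\langle\sigma_j\rangle$, $\Gamma^+(\mathcal Q)=\langle\sigma'_j\rangle$, $\Gamma^+(\mathcal P)\diamondsuit\Gamma^+(\mathcal Q)$ is the subgroup of the direct product generated by $\tau_j=(\sigma_j,\sigma'_j)$; if it has the intersection property w.r.t. the $\tau_j$, the associated polytope is denoted $\mathcal P\diamondsuit\mathcal Q$. Totally chiral: let $W$ be the Coxeter group with generators $r_0,\dots,r_{n-1}$ and relations $r_i^2=(r_ir_j)^2=\epsilon$ for $|i-j|\ge2$, $W^+=\langle s_i=r_{i-1}r_i\rangle$, and $M\trianglelefteq W^+$ with $\Gamma(\mathcal P)=W^+/M$ via $s_i\mapsto\sigma_i$; $\mathcal P$ is totally chiral if $M\,r_0Mr_0^{-1}=W^+$. *)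

(* Defs.v *)
From HB Require Import structures.
From mathcomp Require Import all_boot all_order all_fingroup.
From mathcomp Require Import generic_quotient.
From mathcomp Require boolp.

Set Implicit Arguments.
Unset Strict Implicit.
Unset Printing Implicit Defensive.

Local Open Scope quotient_scope.
Local Open Scope group_scope.

Section Polytopes.
Context {d : Order.disp_t} {T : finTBPOrderType d}.
Implicit Types (x y z : T) (A B Phi Psi : {set T}).

Definition chain A := [forall x in A, forall y in A, (x >=< y)%O].

Definition flag A := maxset chain A.

(* One more than the rank: in an n-polytope [height] runs over 0, .., n.+1,
   the least face (of rank -1) having height 0. *)
Definition height x : nat :=
  \max_(A : {set T} | chain A && [forall y in A, (y < x)%O]) #|A|.

Definition i_adjacent (i : nat) A B :=
  [&& flag A, flag B, A != B &
      [set x in A | height x != i.+1] == [set x in B | height x != i.+1]].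

Definition autgrp := [set f : {perm T} |
  [forall x, forall y, (f x <= f y)%O == (x <= y)%O]].

Lemma autgrp_group_set : group_set autgrp.
Proof.
apply/group_setP; split.
  by rewrite inE; apply/forallP => x; apply/forallP => y; rewrite !perm1.
move=> f g; rewrite !inE => /forallP fP /forallP gP.
apply/forallP => x; apply/forallP => y; rewrite !permM.
by rewrite (eqP (forallP (gP _) _)) (eqP (forallP (fP _) _)).
Qed.
Canonical autgrp_group := Group autgrp_group_set.

Definition flags := [set A | flag A].

End Polytopes.

Arguments autgrp {d} T.
Arguments autgrp_group {d} T.
Arguments flags {d} T.

Section PolytopePredicates.
Variables (n : nat) (d : Order.disp_t) (T : finTBPOrderType d).
Implicit Types (x y z : T) (A B Phi Psi : {set T}).

Definition strongly_flag_connected := forall Phi Psi, flag Phi -> flag Psi ->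
  connect [rel A B : {set T} | [&& Phi :&: Psi \subset A, Phi :&: Psi \subset B &
                         [exists i : 'I_n, i_adjacent i A B]]] Phi Psi.

Definition diamond := forall x y, (x < y)%O -> height y = (height x).+2 ->
  #|[set z | (x < z < y)%O]| = 2.

Definition is_polytope :=
  [/\ forall A : {set T}, flag A -> #|A| = n.+2,
      strongly_flag_connected & diamond].

Definition regular := [transitive autgrp T, on flags T | 'P^*].

Definition chiral :=
  #|orbit 'P^* (autgrp T) @: flags T| = 2 /\
  (forall (i : 'I_n) A B, i_adjacent i A B -> B \notin orbit 'P^* (autgrp T) A).

End PolytopePredicates.

Arguments regular {d} T.

(* Families sigma_1, .., sigma_{n-1} are indexed by nat; only the indices i
   with 0 < i < n matter. *)
Definition rot_group (n : nat) (gT : finGroupType) (s : nat -> gT) : {set gT} :=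
  <<[set s (val i) | i : 'I_n & (0 < i)%N]>>.

Canonical rot_group_group n (gT : finGroupType) (s : nat -> gT) := [group of rot_group n s].

Section Rotations.
Variables (n : nat) (d : Order.disp_t) (T : finTBPOrderType d).
Variable Phi : {set T}.

Definition reflections (rho : nat -> {perm T}) := forall i, (i < n)%N ->
  rho i \in autgrp T /\ i_adjacent i Phi (rho i @: Phi).

Definition rot_of (rho : nat -> {perm T}) (i : nat) : {perm T} :=
  rho i.-1 * rho i.

Definition regular_rotations (s : nat -> {perm T}) :=
  exists2 rho, reflections rho & forall i, (0 < i < n)%N -> s i = rot_of rho i.

(* sigma_i maps the base flag Phi to (Phi^i)^{i-1}, the flag (i-1)-adjacent to
   the one i-adjacent to Phi.  Permutations compose from left to right, so this
   is what rho_{i-1} rho_i does to Phi in the regular case. *)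
Definition chiral_rotations (s : nat -> {perm T}) :=
  forall i, (0 < i < n)%N -> s i \in autgrp T /\
    exists2 Psi, i_adjacent i Phi Psi & i_adjacent i.-1 Psi (s i @: Phi).

End Rotations.

Definition directly_regular n d (T : finTBPOrderType d) :=
  regular T /\ exists (Phi : {set T}) (rho : nat -> {perm T}),
    [/\ flag Phi, reflections n Phi rho &
        #|autgrp T : rot_group n (rot_of rho)| = 2].

Section IntersectionProperty.
Variables (n : nat) (gT : finGroupType) (s : nat -> gT).

Definition kappa (i j : nat) : gT :=
  if (0 < i)%N && (j < n)%N then \prod_(i <= k < j.+1) s k else 1.

(* A set I of ranks in {-1, .., n} is encoded by shifting it by one, so that
   kappa_{i,j} is a generator when i and j + 1 lie in the shifted set. *)
Definition kappa_group (I : {set 'I_n.+2}) : {set gT} :=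
  <<[set kappa (val a) (val b).-1 | a in I, b in I & (a < b)%N]>>.

Definition intersection_property := forall I J : {set 'I_n.+2},
  kappa_group I :&: kappa_group J = kappa_group (I :&: J).

End IntersectionProperty.

Definition mix_gen (gT hT : finGroupType) (s : nat -> gT) (t : nat -> hT)
  (i : nat) : gT * hT := (s i, t i).

Definition mix n (gT hT : finGroupType) (s : nat -> gT) (t : nat -> hT) :=
  rot_group n (mix_gen s t).

Definition isom_on_gens n (gT hT : finGroupType) (G : {set gT})
    (s : nat -> gT) (t : nat -> hT) :=
  exists2 f : {morphism G >-> hT}, isom G (rot_group n t) f &
    forall i, (0 < i < n)%N -> f (s i) = t i.

(* R is the chiral or directly regular n-polytope associated with the group
   generated by t_1, .., t_{n-1}: with respect to the base flag Omega, its
   distinguished rotations u_i correspond to the t_i. *)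
Definition polytope_of n (gT : finGroupType) (t : nat -> gT)
    d (R : finTBPOrderType d) (Omega : {set R}) (u : nat -> {perm R}) :=
  [/\ is_polytope n R, flag Omega &
      [/\ chiral n R, chiral_rotations n Omega u &
          isom_on_gens n (autgrp R) u t] \/
      [/\ directly_regular n R, regular_rotations n Omega u &
          isom_on_gens n (rot_group n u) u t]].

Definition no_subgroup_with_quotient (gT hT : finGroupType)
    (G : {set gT}) (K : {set hT}) :=
  forall H N : {group gT}, H \subset G -> N <| H -> ~ (H / N \isog K).

Inductive gen_by (G : groupType) (S : G -> Prop) : G -> Prop :=
| gen_by_in x of S x : gen_by S x
| gen_by_1 : gen_by S 1
| gen_by_M x y of gen_by S x & gen_by S y : gen_by S (x * y)
| gen_by_V x of gen_by S x : gen_by S x^-1.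

Section Coxeter.
Variable n : nat.
Implicit Types (u v w : seq 'I_n) (i j : 'I_n).

(* The r_i being involutions, words without inverses suffice, and inversion is
   reversal. *)
Inductive cox_eq : seq 'I_n -> seq 'I_n -> Prop :=
| cox_refl u : cox_eq u u
| cox_sym u v of cox_eq u v : cox_eq v u
| cox_trans u v w of cox_eq u v & cox_eq v w : cox_eq u w
| cox_sq u v i : cox_eq (u ++ [:: i; i] ++ v) (u ++ v)
| cox_comm u v i j of (i.+1 < j)%N || (j.+1 < i)%N :
    cox_eq (u ++ [:: i; j; i; j] ++ v) (u ++ v).

Definition cox_rel u v := boolp.asbool (cox_eq u v).

Lemma cox_rel_is_equiv : equiv_class_of cox_rel.
Proof.
split=> [u | u v | v u w].
- by apply/boolp.asboolP; apply: cox_refl.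
- by apply/boolp.asboolP/boolp.asboolP; apply: cox_sym.
- by move=> /boolp.asboolP uv /boolp.asboolP vw; apply/boolp.asboolP;
    apply: cox_trans vw.
Qed.

Canonical cox_equiv := EquivRelPack cox_rel_is_equiv.

Definition cox := {eq_quot cox_equiv}.
HB.instance Definition _ := Choice.on cox.
HB.instance Definition _ := Quotient.on cox.

Definition cox_word (u : seq 'I_n) : cox := \pi_cox u.

Lemma cox_wordP u v : reflect (cox_word u = cox_word v) (cox_rel u v).
Proof. exact: (@eqmodP _ cox_equiv u v). Qed.

Lemma cox_eq_catl w u v : cox_eq u v -> cox_eq (w ++ u) (w ++ v).
Proof.
elim=> [u1|u1 v1 _|u1 v1 w1 _ IH1 _|u1 v1 i|u1 v1 i j ij].
- exact: cox_refl.
- exact: cox_sym.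
- exact: cox_trans.
- by rewrite [in X in cox_eq X]catA [X in cox_eq _ X]catA; apply: cox_sq.
- by rewrite [in X in cox_eq X]catA [X in cox_eq _ X]catA; apply: cox_comm.
Qed.

Lemma cox_eq_catr w u v : cox_eq u v -> cox_eq (u ++ w) (v ++ w).
Proof.
elim=> [u1|u1 v1 _|u1 v1 w1 _ IH1 _|u1 v1 i|u1 v1 i j ij].
- exact: cox_refl.
- exact: cox_sym.
- exact: cox_trans.
- by rewrite -!catA; apply: cox_sq.
- by rewrite -!catA; apply: cox_comm.
Qed.

Lemma cox_eq_rev u v : cox_eq u v -> cox_eq (rev u) (rev v).
Proof.
elim=> [u1|u1 v1 _|u1 v1 w1 _ IH1 _|u1 v1 i|u1 v1 i j ij].
- exact: cox_refl.
- exact: cox_sym.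
- exact: cox_trans.
- by rewrite !rev_cat -!catA; apply: cox_sq.
- by rewrite !rev_cat -!catA; apply: cox_comm; rewrite orbC.
Qed.

Lemma cox_eq_revK u : cox_eq (rev u ++ u) [::].
Proof.
elim: u => [|i u IHu]; first exact: cox_refl.
rewrite rev_cons -cats1 -catA; apply: cox_trans IHu.
exact: (cox_sq (rev u) u i).
Qed.

Definition cox_mul (x y : cox) : cox := cox_word (repr x ++ repr y).
Definition cox_inv (x : cox) : cox := cox_word (rev (repr x)).

Lemma cox_reprK x : cox_word (repr x) = x.
Proof. exact: reprK. Qed.

Lemma cox_repr u : cox_eq (repr (cox_word u)) u.
Proof. exact/boolp.asboolP/cox_wordP/cox_reprK. Qed.

Lemma cox_word_eq u v : cox_eq u v -> cox_word u = cox_word v.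
Proof. by move=> uv; apply/cox_wordP/boolp.asboolP. Qed.

Lemma cox_wordM u v : cox_mul (cox_word u) (cox_word v) = cox_word (u ++ v).
Proof.
apply: cox_word_eq; apply: (@cox_trans _ (u ++ repr (cox_word v))).
  exact/cox_eq_catr/cox_repr.
exact/cox_eq_catl/cox_repr.
Qed.

Lemma cox_wordV u : cox_inv (cox_word u) = cox_word (rev u).
Proof. exact/cox_word_eq/cox_eq_rev/cox_repr. Qed.

Lemma cox_mulA : associative cox_mul.
Proof.
move=> x y z; rewrite -(cox_reprK x) -(cox_reprK y) -(cox_reprK z).
by rewrite !cox_wordM catA.
Qed.

Lemma cox_mul1 : left_id (cox_word [::]) cox_mul.
Proof. by move=> x; rewrite -(cox_reprK x) cox_wordM. Qed.

Lemma cox_mulr1 : right_id (cox_word [::]) cox_mul.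
Proof. by move=> x; rewrite -(cox_reprK x) cox_wordM cats0. Qed.

Lemma cox_mulV : left_inverse (cox_word [::]) cox_inv cox_mul.
Proof.
move=> x; rewrite -(cox_reprK x) cox_wordV cox_wordM.
exact/cox_word_eq/cox_eq_revK.
Qed.

Lemma cox_mulrV : right_inverse (cox_word [::]) cox_inv cox_mul.
Proof.
move=> x; rewrite -(cox_reprK x) cox_wordV cox_wordM.
by apply/cox_word_eq; rewrite -{1}[repr x]revK; apply/cox_eq_revK.
Qed.

HB.instance Definition _ :=
  isGroup.Build cox cox_mulA cox_mul1 cox_mulr1 cox_mulV cox_mulrV.

(* Only the indices i < n matter. *)
Definition cox_r (i : nat) : cox :=
  if insub i is Some k then cox_word [:: k] else 1.

Definition cox_s (i : nat) : cox := cox_r i.-1 * cox_r i.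

Definition cox_plus : cox -> Prop :=
  gen_by (fun x : cox => exists2 i, (0 < i < n)%N & x = cox_s i).

End Coxeter.

(* M is the kernel of the epimorphism W^+ -> Gamma(P), s_i |-> sigma_i, so that
   W^+ / M = Gamma(P); only the restriction of phi to W^+ matters. *)
Definition totally_chiral n (gT : finGroupType) (s : nat -> gT) :=
  exists phi : cox n -> gT,
    [/\ forall x y, cox_plus x -> cox_plus y -> phi (x * y) = phi x * phi y,
        forall i, (0 < i < n)%N -> phi (cox_s n i) = s i &
        let M w := cox_plus w /\ phi w = 1 in
        forall w : cox n, cox_plus w <->
          exists m m', [/\ M m, M m' &
                           w = m * (cox_r n 0 * m' * (cox_r n 0)^-1)]].

(* Main.v *)
Require Import Defs.
From HB Require Import structures.
From mathcomp Require Import all_boot all_order all_fingroup cyclic zify.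

Set Implicit Arguments.
Unset Strict Implicit.
Unset Printing Implicit Defensive.

Import Order.POrderTheory.

Local Open Scope group_scope.

(** Everything is read off flag graphs.  Let M be the set of pairs of flags of
    P and Q of the same colour, where the colours are the two orbits of the
    rotation group, and let i-adjacency act on both coordinates at once.  Since
    p_j and q_j are coprime, a power of the rotation r_{j-1} r_j moves the
    second flag one step while fixing the first; hence a walk with letters in I
    can move the two coordinates independently, subject only to the condition
    that, for each rank k outside I, both use letters below k with the same
    parity.  These parities are determined by the endpoints, so two elements of
    M linked by an I-walk and by a J-walk are linked by a walk with letters in
    the intersection of I and J.  An element of the mix belongs to the subgroup
    of the rank set I exactly when an I-walk links the base flag to its image,
    so this is the intersection property of the mix.  By the same property of
    walks, the orbits of the walks avoiding one letter are the faces of an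
    n-polytope with flag set M, on which the mix acts with the two colour
    classes as orbits; it is directly regular or chiral according to whether
    some automorphism exchanges the colours.

    If that polytope were directly regular, the projection of the mix onto
    Gamma(P), paired with its composite with the conjugation by rho_0, would by
    total chirality be onto Gamma(P) x Gamma(P). *)

(** * Walks in edge-coloured graphs *)

(* A step along the letter i changes the face of height i.+1. *)
Definition step_height n (i : 'I_n) : 'I_n.+2 := inord i.+1.

Lemma val_step_height n (i : 'I_n) : step_height i = i.+1 :> nat.
Proof. by apply: inordK; rewrite !ltnS ltnW. Qed.

Section Walks.
Variables (n : nat) (X : finType) (r : 'I_n -> X -> X).
Implicit Types (I J : pred 'I_n) (i j : 'I_n) (w : seq 'I_n) (x y : X).
Implicit Types (c : X -> bool) (h : nat).

Definition walk w x := foldr r x w.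

Definition linked I x y :=
  connect [rel x y | [exists i, I i && (r i x == y)]] x y.

Definition far i : pred 'I_n := fun j => (i.+1 < j)%N || (j.+1 < i)%N.

Definition below h : pred 'I_n := fun i => (i.+1 < h)%N.
Definition above h : pred 'I_n := fun i => (h <= i)%N.
Definition avoiding h : pred 'I_n := fun i => i.+1 != h.

Definition involutive_steps := forall i, involutive (r i).
Definition far_commuting := forall i j x, far i j -> r i (r j x) = r j (r i x).
Definition alternating c := forall i x, c (r i x) = ~~ c x.
Definition connected_steps := forall x y, linked predT x y.
Definition path_intersection := forall I J x y,
  linked I x y -> linked J x y -> linked (predI I J) x y.

Lemma walk_cat w1 w2 x : walk (w1 ++ w2) x = walk w1 (walk w2 x).
Proof. exact: foldr_cat. Qed.

Lemma linkedP I x y :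
  reflect (exists2 w, all I w & walk w x = y) (linked I x y).
Proof.
apply: (iffP connectP) => [[p px ->] | [w Iw <-]].
  elim: p x px => [|z p IHp] x /=; first by exists [::].
  case/andP => /existsP[i /andP[Ii /eqP <-]] /IHp[w Iw w_last].
  exists (rcons w i); first by rewrite all_rcons Ii.
  by rewrite -cats1 walk_cat.
elim: w Iw => [|i w IHw] /=; first by exists [::].
case/andP => Ii /IHw[p px p_last]; exists (rcons p (r i (walk w x))).
  by rewrite rcons_path px /= -p_last; apply/existsP; exists i; rewrite Ii /=.
by rewrite last_rcons.
Qed.

Lemma linked_refl I x : linked I x x.
Proof. exact: connect0. Qed.

Lemma linked_trans I : transitive (linked I).
Proof. by move=> y x z; apply: connect_trans. Qed.

Lemma linked_sub I J x y : subpred I J -> linked I x y -> linked J x y.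
Proof.
move=> sIJ /linkedP[w Iw <-]; apply/linkedP; exists w => //.
exact: sub_all Iw.
Qed.

Lemma linked_walk I w x : all I w -> linked I x (walk w x).
Proof. by move=> Iw; apply/linkedP; exists w. Qed.

Lemma linked_step I i x : I i -> linked I x (r i x).
Proof. by move=> Ii; apply: (@linked_walk I [:: i]); rewrite /= Ii. Qed.

Lemma linked_pred0 I x y : I =1 pred0 -> linked I x y -> x = y.
Proof. by move=> I0 /linkedP[[|i w] //=]; rewrite I0. Qed.

Lemma colour_walk c w x : alternating c -> c (walk w x) = odd (size w) (+) c x.
Proof. by move=> c_alt; elim: w => //= i w IHw; rewrite c_alt IHw addNb. Qed.

Lemma even_walk c w x : alternating c -> c (walk w x) = c x -> ~~ odd (size w).
Proof. by move=> c_alt; rewrite colour_walk //; case: odd (c x) => [] []. Qed.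

Lemma alternating_step c x y i : alternating c -> c x != c y -> c (r i x) = c y.
Proof. by move=> ->; case: (c x) (c y) => [] []. Qed.

Lemma alternating_eqb c b : alternating c -> alternating (fun x => c x == b).
Proof. by move=> c_alt i x; rewrite c_alt; case: (c x) b => [] []. Qed.

Hypothesis rK : involutive_steps.

Lemma walk_revK w : cancel (walk w) (walk (rev w)).
Proof.
elim: w => [|i w IHw] x //=.
by rewrite rev_cons -cats1 walk_cat /= rK IHw.
Qed.

Lemma walk_revKV w : cancel (walk (rev w)) (walk w).
Proof. by move=> x; have := walk_revK (rev w) x; rewrite revK. Qed.

Lemma linked_sym I x y : linked I x y -> linked I y x.
Proof.
case/linkedP=> w Iw <-; apply/linkedP; exists (rev w); first by rewrite all_rev.
exact: walk_revK.
Qed.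

Lemma iter_rotation_rev i j m x :
  iter m (r i \o r j) (r j (iter m (r i \o r j) x)) = r j x.
Proof.
by elim: m => // m IHm; rewrite [in iter m.+1 _ x]iterS iterSr /= !rK.
Qed.

Hypothesis rC : far_commuting.

Lemma walk_far i w x : all (far i) w -> r i (walk w x) = walk w (r i x).
Proof. by elim: w => //= j w IHw /andP[ij /IHw <-]; rewrite rC. Qed.

Lemma walk_cox_eq w v x : cox_eq w v -> walk w x = walk v x.
Proof.
elim=> {w v} [//|w v _ -> //|w v u _ -> _ -> //|w v i|w v i j far_ij].
  by rewrite !walk_cat /= rK.
by rewrite !walk_cat /= (rC _ far_ij) !rK.
Qed.

Lemma linked_far i x y : linked (predU (pred1 i) (far i)) x y ->
  linked (far i) x y \/ linked (far i) (r i x) y.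
Proof.
case/linkedP=> w Iw <-; elim: w Iw => [|j w IHw] /=.
  by left; apply: linked_refl.
case/andP=> /orP[/eqP-> | far_ij] /IHw{IHw}[] /linkedP[v far_v <-].
- by right; rewrite walk_far //; apply: linked_walk.
- by left; rewrite -walk_far // rK; apply: linked_walk.
- by left; apply: (@linked_walk _ (j :: v)); rewrite /= far_ij.
- by right; apply: (@linked_walk _ (j :: v)); rewrite /= far_ij.
Qed.

Lemma walk_above_below h w x : all (avoiding h) w ->
  walk w x = walk (filter (above h) w) (walk (filter (below h) w) x).
Proof.
elim: w => //= i w IHw /andP[neq_ih /IHw ->]; rewrite /above /below.
rewrite /avoiding in neq_ih.
have [le_hi | lt_ih] := leqP h i; first by rewrite ltnNge leqW.
rewrite ltn_neqAle neq_ih lt_ih /=.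
by apply: walk_far; apply/allP => j; rewrite mem_filter /far; lia.
Qed.

(* By the intersection property the lower parts of the two walks have the same
   effect, so their parities are read off the colour. *)
Lemma odd_count_below c h w v x : alternating c -> path_intersection ->
    all (avoiding h) w -> all (avoiding h) v -> walk w x = walk v x ->
  odd (count (below h) w) = odd (count (below h) v).
Proof.
move=> c_alt r_int hw hv.
rewrite (walk_above_below x hw) (walk_above_below x hv).
set lw := filter (below h) w; set lv := filter (below h) v.
set uw := filter (above h) w; set uv := filter (above h) v => eq_wv.
have eq_lower : walk lw x = walk lv x.
  apply: (@linked_pred0 (predI (below h) (above h))).
    by move=> i; rewrite /= /below /above; lia.
  apply: r_int; apply/linkedP.
    exists (lv ++ rev lw); last by rewrite walk_cat walk_revK.
    by rewrite all_cat all_rev !filter_all.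
  exists (rev uv ++ uw); last by rewrite walk_cat eq_wv walk_revK.
  by rewrite all_cat all_rev !filter_all.
have := congr1 c eq_lower; rewrite !colour_walk // !size_filter.
exact: addIb.
Qed.

End Walks.

Definition independent_rotations n (X Y : finType)
    (r : 'I_n -> X -> X) (q : 'I_n -> Y -> Y) :=
  forall i j : 'I_n, i.+1 = j -> exists m,
    iter m (r i \o r j) =1 id /\ iter m (q i \o q j) =1 q i \o q j.

(** * Mixing walks with independent rotations *)

Section FreeMoves.
Variables (n : nat) (X Y : finType) (r : 'I_n -> X -> X) (q : 'I_n -> Y -> Y).
Hypotheses (rK : involutive_steps r) (qK : involutive_steps q).
Hypotheses (qC : far_commuting q) (indep : independent_rotations r q).
Variable I : pred 'I_n.
Implicit Types (i j k : 'I_n) (u w : seq 'I_n).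

Definition free_move (f : Y -> Y) := forall x y,
  exists w, [/\ all I w, walk r w x = x & walk q w y = f y].

Lemma eq_free_move f g : f =1 g -> free_move f -> free_move g.
Proof.
move=> fg free_f x y; have [w [Iw wx wy]] := free_f x y.
by exists w; rewrite -fg.
Qed.

Lemma free_move_id : free_move id.
Proof. by move=> x y; exists [::]. Qed.

Lemma free_move_comp f g : free_move f -> free_move g -> free_move (f \o g).
Proof.
move=> free_f free_g x y; have [v [Iv vx vy]] := free_g x y.
have [w [Iw wx wy]] := free_f x (g y).
by exists (w ++ v); rewrite all_cat Iv Iw !walk_cat vx vy.
Qed.

Lemma free_move_conj w f : all I w -> free_move f ->
  free_move (walk q w \o f \o walk q (rev w)).
Proof.
move=> Iw free_f x y.
have [v [Iv vx vy]] := free_f (walk r (rev w) x) (walk q (rev w) y).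
exists (w ++ v ++ rev w); rewrite !all_cat all_rev Iw Iv !walk_cat vx vy.
by rewrite walk_revKV.
Qed.

Lemma free_move_sym i j :
  I j -> free_move (q i \o q j) -> free_move (q j \o q i).
Proof.
move=> Ij /(@free_move_conj [:: j]); rewrite /= Ij => /(_ isT).
by apply: eq_free_move => y /=; rewrite qK.
Qed.

Lemma free_move_succ i j : I i -> I j -> i.+1 = j -> free_move (q i \o q j).
Proof.
move=> Ii Ij /indep[m [rm qm]] x y; exists (flatten (nseq m [:: i; j])).
have walk_iter (Z : finType) (p : 'I_n -> Z -> Z) z :
    walk p (flatten (nseq m [:: i; j])) z = iter m (p i \o p j) z.
  by elim: m {rm qm} => //= m ->.
rewrite !walk_iter rm qm; split=> //.
by elim: m {rm qm walk_iter} => //= m ->; rewrite Ii Ij.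
Qed.

Definition gap (k : nat) := if insub k is Some i then ~~ I i else true.

(* Letters of I carry the same label when no letter outside I separates them. *)
Definition label (k : nat) := count gap (iota 0 k).

Lemma gap_ord i : gap i = ~~ I i.
Proof. by rewrite /gap valK. Qed.

Lemma labelS (m : nat) : label m.+1 = (label m + gap m)%N.
Proof. by rewrite /label -addn1 iotaD count_cat /= addn0. Qed.

Lemma labelS_in i : I i -> label i.+1 = label i.
Proof. by move=> Ii; rewrite labelS gap_ord Ii addn0. Qed.

Lemma leq_label : {homo label : m l / (m <= l)%N}.
Proof.
apply: homo_leq => [m||m]; [exact: leqnn | exact: leq_trans |].
by rewrite labelS leq_addr.
Qed.

Lemma far_label i k : I i -> I k -> label k != label i -> far i k.
Proof.
move=> Ii Ik; apply: contraR => near_ik.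
have [lt_ik|lt_ki|->//] := ltngtP i k.
  have -> : k = i.+1 :> nat by move: near_ik; rewrite /far; lia.
  by rewrite labelS_in.
have -> : i = k.+1 :> nat by move: near_ik; rewrite /far; lia.
by rewrite labelS_in.
Qed.

Lemma free_move_label i j : I i -> I j -> label i = label j ->
  free_move (q i \o q j).
Proof.
wlog le_ij : i j / (i <= j)%N => [IH Ii Ij eq_ij|].
  by have [/IH|/ltnW/IH IHji] := leqP i j; [exact | exact/free_move_sym/IHji].
move: {2}(j - i) (erefl (j - i)) => d.
elim: d j le_ij => [|d IHd] j le_ij dist_ij Ii Ij eq_ij.
  have -> : j = i by apply: val_inj => /=; lia.
  by apply: eq_free_move free_move_id => y /=; rewrite qK.
have ltkn : (j.-1 < n)%N by have := ltn_ord j; lia.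
pose k := Ordinal ltkn; have jE : j = k.+1 :> nat by rewrite /=; lia.
have le_ik : (i <= k)%N by rewrite /=; lia.
have le_lik := leq_label le_ik.
have label_j := labelS k; rewrite gap_ord -jE -eq_ij in label_j.
have Ik : I k by apply: contraLR le_lik => /negbTE Ik; rewrite label_j Ik; lia.
apply: (@eq_free_move ((q i \o q k) \o (q k \o q j))).
  by move=> y /=; rewrite qK.
apply: free_move_comp; last exact: free_move_succ.
by apply: IHd => //; [rewrite /=|]; lia.
Qed.

Lemma free_move_walk u : all I u ->
  (forall m, ~~ odd (count (fun i => label i == m) u)) -> free_move (walk q u).
Proof.
have [N] := ubnP (size u); elim: N u => // N IHN [|i u] /= leN.
  by move=> _ _; apply: free_move_id.
case/andP=> Ii Iu even_u.
have has_u : has (fun j => label j == label i) u.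
  by have := even_u (label i); rewrite eqxx has_count; lia.
case: (split_find has_u) Iu even_u leN => j a b /eqP label_j a_i.
rewrite -cats1 -catA all_cat /= => /and3P[Ia Ij Ib] even_u.
rewrite size_cat /= => leN.
have far_ia : all (far i) a.
  apply/allP => k ka; have /hasPn/(_ k ka) := a_i.
  exact: far_label Ii (allP Ia k ka).
apply: (@eq_free_move
    ((walk q a \o (q i \o q j) \o walk q (rev a)) \o walk q (a ++ b))).
  by move=> y /=; rewrite !walk_cat /= walk_revK // (walk_far qC _ far_ia).
apply: free_move_comp; first exact/(free_move_conj Ia)/free_move_label.
apply: IHN; first by rewrite size_cat; lia.
  by rewrite all_cat Ia.
move=> m; have := even_u m; rewrite !count_cat /= label_j.
by case: (label i == m) => /=; lia.
Qed.

Lemma label_lt_cut m : (0 < m <= label n)%N ->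
  exists2 k, ~~ I k & forall i, I i -> (label i < m)%N = (i < k)%N.
Proof.
case/andP=> m_gt0 le_mn.
have [|[|l] le_ml min_l] := @ex_minnP (fun l : nat => m <= label l)%N.
- by exists n.
- by move: le_ml; rewrite leqNgt m_gt0.
have lt_ln : (l < n)%N by apply: min_l.
have lt_lm : (label l < m)%N.
  by rewrite ltnNge; apply/negP => /min_l; rewrite ltnn.
have gap_l : gap l by move: le_ml; rewrite labelS; case: gap => //; lia.
exists (Ordinal lt_ln) => [|i Ii /=]; first by rewrite -gap_ord.
apply/idP/idP => [|/ltnW/leq_label le_il]; last exact: leq_ltn_trans lt_lm.
apply: contraTT; rewrite -!leqNgt leq_eqVlt => /predU1P[eq_li | /leq_label].
  by move: gap_l; rewrite eq_li gap_ord Ii.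
exact: leq_trans.
Qed.

Lemma even_count_label u : all I u -> ~~ odd (size u) ->
    (forall k, ~~ I k -> ~~ odd (count (below k.+1) u)) ->
  forall m, ~~ odd (count (fun i => label i == m) u).
Proof.
move=> Iu even_u even_below.
have even_lt m : ~~ odd (count (fun i => label i < m)%N u).
  have [->|m_gt0] := posnP m.
    by rewrite (@eq_count _ _ pred0) ?count_pred0.
  have [le_m|lt_m] := leqP m (label n).
    have [|k Ik cut_k] := @label_lt_cut m; first by rewrite m_gt0.
    rewrite (@eq_in_count _ _ (below k.+1)) ?even_below // => i iu.
    by rewrite /below ltnS cut_k // (allP Iu).
  rewrite (@eq_count _ _ predT) ?count_predT // => i.
  by apply: leq_ltn_trans lt_m; apply/leq_label/ltnW.
move=> m; have := even_lt m.+1.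
rewrite (_ : count _ u = count (fun i => label i < m)%N u +
                         count (fun i => label i == m) u)%N.
  by rewrite oddD (negbTE (even_lt m)).
rewrite -count_predUI [X in (_ + X)%N](@eq_count _ _ pred0); last first.
  by move=> i /=; lia.
rewrite count_pred0 addn0; apply: eq_count => i /=.
by rewrite ltnS leq_eqVlt orbC.
Qed.

Lemma simultaneous_walk z v x y : all I z -> all I v ->
    odd (size z) = odd (size v) ->
    (forall k, ~~ I k ->
       odd (count (below k.+1) z) = odd (count (below k.+1) v)) ->
  exists w, [/\ all I w, walk r w x = walk r z x & walk q w y = walk q v y].
Proof.
move=> Iz Iv size_zv count_zv.
have Ivz : all I (v ++ rev z) by rewrite all_cat all_rev Iz Iv.
case: (free_move_walk Ivz _ (walk r z x) (walk q z y)) => [|w [Iw wx wy]].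
  apply: even_count_label => //.
    by rewrite size_cat size_rev oddD size_zv addbb.
  by move=> k /count_zv; rewrite count_cat count_rev oddD => ->; rewrite addbb.
exists (w ++ z); rewrite all_cat Iw.
by rewrite !walk_cat wx wy walk_cat walk_revK.
Qed.

End FreeMoves.

(* An orientable maniplex, its colour classes being the two orientations; the
   path intersection property makes it the flag graph of a polytope. *)
Record maniplex (n : nat) := Maniplex {
  mflag :> finType;
  step : 'I_n -> mflag -> mflag;
  stepK : involutive_steps step;
  stepC : far_commuting step;
  colour : mflag -> bool;
  colour_step : alternating step colour;
  step_connected : connected_steps step;
  step_intersection : path_intersection step;
  base_flag : mflag }.

Lemma maniplex_odd_count_below n (M : maniplex n) h w v (x : M) :
    all (avoiding h) w -> all (avoiding h) v ->
    walk (@step n M) w x = walk (@step n M) v x ->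
  odd (count (below h) w) = odd (count (below h) v).
Proof.
exact: (odd_count_below (@stepK n M) (@stepC n M) (@colour_step n M)
  (@step_intersection n M)).
Qed.

Section MixManiplex.
Variables (n : nat) (M N : maniplex n).
Hypothesis indep : independent_rotations (@step n M) (@step n N).
Hypothesis same_base_colour : colour (base_flag M) = colour (base_flag N).
Implicit Types (i k : 'I_n) (I : pred 'I_n).

Definition mix_flag := {xy : M * N | colour xy.1 == colour xy.2}.
Implicit Types xy uv : mix_flag.

Fact mix_step_subproof i xy :
  colour (step i (val xy).1) == colour (step i (val xy).2).
Proof. by rewrite !colour_step (eqP (valP xy)). Qed.

Definition mix_step i xy : mix_flag :=
  exist _ (step i (val xy).1, step i (val xy).2) (mix_step_subproof i xy).

Definition mix_base_flag : mix_flag :=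
  exist _ (base_flag M, base_flag N) (introT eqP same_base_colour).

Definition mix_colour xy := colour (val xy).1.

Lemma val_mix_walk w xy : val (walk mix_step w xy) =
  (walk (@step n M) w (val xy).1, walk (@step n N) w (val xy).2).
Proof. by elim: w => [|i w /= ->] //=; case: (val xy). Qed.

Lemma mix_stepK : involutive_steps mix_step.
Proof. by move=> i xy; apply: val_inj; rewrite /= !stepK; case: (val xy). Qed.

Lemma mix_stepC : far_commuting mix_step.
Proof.
by move=> i j xy far_ij; apply: val_inj; rewrite /= !(stepC _ far_ij).
Qed.

Lemma mix_colour_step : alternating mix_step mix_colour.
Proof. by move=> i xy; apply: colour_step. Qed.

Lemma mix_linked I xy uv z v : all I z -> all I v ->
    walk (@step n M) z (val xy).1 = (val uv).1 ->
    walk (@step n N) v (val xy).2 = (val uv).2 ->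
    (forall k, ~~ I k ->
       odd (count (below k.+1) z) = odd (count (below k.+1) v)) ->
  linked mix_step I xy uv.
Proof.
move=> Iz Iv zE vE zv.
have size_zv : odd (size z) = odd (size v).
  have := eqP (valP uv); rewrite /= -zE -vE.
  by rewrite !(colour_walk _ _ (@colour_step _ _)) (eqP (valP xy)) => /addIb.
have [w [Iw wz wv]] := simultaneous_walk (@stepK n M) (@stepK n N) (@stepC n N)
  indep (val xy).1 (val xy).2 Iz Iv size_zv zv.
apply/linkedP; exists w => //; apply: val_inj.
by rewrite val_mix_walk wz wv zE vE; case: (val uv).
Qed.

Lemma mix_connected : connected_steps mix_step.
Proof.
move=> xy uv.
have /linkedP[z _ zE] := step_connected (val xy).1 (val uv).1.
have /linkedP[v _ vE] := step_connected (val xy).2 (val uv).2.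
by apply: (@mix_linked _ _ _ z v) => //; apply/allP.
Qed.

Lemma mix_path_intersection : path_intersection mix_step.
Proof.
move=> I J xy uv /linkedP[w Iw wE] /linkedP[v Jv vE].
have [w1 w2] := (congr1 (fst \o val) wE, congr1 (snd \o val) wE).
have [v1 v2] := (congr1 (fst \o val) vE, congr1 (snd \o val) vE).
rewrite /= !val_mix_walk /= in w1 w2 v1 v2.
have /linkedP[z IJz zE] : linked (@step n M) (predI I J) (val xy).1 (val uv).1.
  by apply: step_intersection; apply/linkedP; [exists w | exists v].
have /linkedP[z' IJz' z'E] :
    linked (@step n N) (predI I J) (val xy).2 (val uv).2.
  by apply: step_intersection; apply/linkedP; [exists w | exists v].
apply: (mix_linked IJz IJz' zE z'E) => k IJk.
have avoiding_k K u : ~~ K k -> all K u -> all (avoiding k.+1) u.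
  move=> Kk; apply: sub_all => l Kl.
  by rewrite /avoiding eqSS; apply: contraNneq Kk => /val_inj <-.
have same_parity u : all (avoiding k.+1) u ->
    walk (@step n M) u (val xy).1 = (val uv).1 ->
    walk (@step n N) u (val xy).2 = (val uv).2 ->
    odd (count (below k.+1) z) = odd (count (below k.+1) z').
  move=> ku u1 u2; rewrite -u1 in zE; rewrite -u2 in z'E.
  rewrite (maniplex_odd_count_below (avoiding_k _ _ IJk IJz) ku zE).
  by rewrite (maniplex_odd_count_below (avoiding_k _ _ IJk IJz') ku z'E).
move: IJk; rewrite /= negb_and => /orP[Ik|Jk].
  exact: same_parity (avoiding_k _ _ Ik Iw) w1 w2.
exact: same_parity (avoiding_k _ _ Jk Jv) v1 v2.
Qed.

Definition mix_maniplex : maniplex n :=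
  Maniplex mix_stepK mix_stepC mix_colour_step mix_connected
    mix_path_intersection mix_base_flag.

End MixManiplex.

(** * Flags of a ranked poset *)

Section Flags.
Context {d : Order.disp_t} {T : finTBPOrderType d}.
Implicit Types (x y z : T) (A B : {set T}).

Lemma chainP A : reflect {in A &, forall x y, (x >=< y)%O} (chain A).
Proof.
apply: (iffP forall_inP) => chA x => [y xA yA | xA].
  exact: (forall_inP (chA x xA)).
by apply/forall_inP => y; apply: chA.
Qed.

Lemma chain_sub A B : A \subset B -> chain B -> chain A.
Proof.
move=> /subsetP sAB /chainP chB; apply/chainP => x y /sAB xB /sAB yB.
exact: chB.
Qed.

Lemma flag_chain A : flag A -> chain A.
Proof. exact: maxsetp. Qed.

Lemma chain_flag A : chain A -> exists2 B, flag B & A \subset B.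
Proof. by move=> /(@maxset_exists _ _ _)[B flB sAB]; exists B. Qed.

Lemma mem_flag x : exists2 A, flag A & x \in A.
Proof.
have [] := @chain_flag [set x].
  by apply/chainP => y z /set1P-> /set1P->; apply: comparablexx.
by move=> A flA; rewrite sub1set => xA; exists A.
Qed.

Lemma i_adjacent_sym i A B : i_adjacent i A B = i_adjacent i B A.
Proof.
rewrite /i_adjacent [A == B]eq_sym.
by rewrite [[set _ in A | _] == _]eq_sym andbCA.
Qed.

Section Automorphism.
Variable g : {perm T}.
Hypothesis autg : g \in autgrp T.

Lemma aut_le : {mono g : x y / (x <= y)%O}.
Proof.
by move=> x y; move: autg; rewrite inE => /forallP/(_ x)/forallP/(_ y)/eqP.
Qed.

Lemma aut_lt : {mono g : x y / (x < y)%O}.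
Proof. by move=> x y; rewrite !lt_neqAle aut_le (inj_eq perm_inj). Qed.

Lemma aut_chain A : chain A -> chain (g @: A).
Proof.
move=> /chainP chA; apply/chainP => _ _ /imsetP[x xA ->] /imsetP[y yA ->].
by rewrite /Order.comparable !aut_le; apply: chA.
Qed.

End Automorphism.

Lemma aut_flag (g : {perm T}) A : g \in autgrp T -> flag A -> flag (g @: A).
Proof.
move=> autg /maxsetP[chA maxA]; apply/maxsetP.
split=> [|B chB sgAB]; first exact: aut_chain.
have gVK : cancel (fun C : {set T} => g @: C) (fun C : {set T} => g^-1 @: C).
  by move=> C; rewrite -imset_comp (eq_imset _ (permK g)) imset_id.
have gKV : cancel (fun C : {set T} => g^-1 @: C) (fun C : {set T} => g @: C).
  by move=> C; rewrite -imset_comp (eq_imset _ (permKV g)) imset_id.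
rewrite -(maxA (g^-1 @: B)) ?gKV //; first by rewrite aut_chain ?groupV.
by rewrite -[A]gVK imsetS.
Qed.

Lemma aut_height (g : {perm T}) x : g \in autgrp T -> height (g x) = height x.
Proof.
have height_le (f : {perm T}) y :
    f \in autgrp T -> (height y <= height (f y))%N.
  move=> autf; apply/bigmax_leqP => C /andP[chC /forall_inP Cy].
  rewrite -(card_imset C (@perm_inj _ f)); apply: bigmax_sup (leqnn _).
  rewrite aut_chain //; apply/forall_inP => _ /imsetP[z zC ->].
  by rewrite aut_lt ?Cy.
move=> autg; apply/eqP; rewrite eqn_leq height_le //.
by have := height_le g^-1 (g x); rewrite groupV permK => ->.
Qed.

Lemma aut_adjacent (g : {perm T}) i A B : g \in autgrp T ->
  i_adjacent i A B -> i_adjacent i (g @: A) (g @: B).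
Proof.
move=> autg /and4P[flA flB neqAB /eqP eqAB].
have imset_height (C : {set T}) : [set x in g @: C | height x != i.+1] =
    g @: [set x in C | height x != i.+1].
  apply/setP => y; rewrite inE; apply/andP/imsetP => [[/imsetP[x xC ->]] | [x]].
    by rewrite aut_height //; exists x; rewrite // inE xC.
  by rewrite inE => /andP[xC hx] ->; rewrite imset_f ?aut_height.
apply/and4P; split; rewrite ?aut_flag //.
  by rewrite (inj_eq (imset_inj perm_inj)).
by rewrite !imset_height eqAB.
Qed.

End Flags.

Definition flags_have_size n d (T : finTBPOrderType d) :=
  forall A : {set T}, flag A -> #|A| = n.+2.

Section RankedPoset.
Variables (n : nat) (d : Order.disp_t) (T : finTBPOrderType d).
Hypothesis flag_size : flags_have_size n T.
Implicit Types (x y z u v : T) (A B : {set T}) (h k : nat).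

Lemma flagE A : flag A = chain A && (#|A| == n.+2).
Proof.
apply/idP/andP => [flA | [/chain_flag[B flB sAB] /eqP cardA]].
  by rewrite flag_chain // flag_size.
suff -> : A = B by [].
by apply/eqP; rewrite eqEcard sAB cardA flag_size ?leqnn.
Qed.

Lemma height_flag A x : flag A -> x \in A ->
  height x = #|[set y in A | (y < x)%O]|.
Proof.
move=> flA xA; have /chainP chA := flag_chain flA.
apply/eqP; rewrite eqn_leq; apply/andP; split; last first.
  apply: (bigmax_sup [set y in A | (y < x)%O]) => //; apply/andP; split.
    apply: chain_sub (flag_chain flA); apply/subsetP=> y.
    by rewrite inE => /andP[].
  by apply/forall_inP => y; rewrite inE => /andP[].
apply/bigmax_leqP => C /andP[/chainP chC /forall_inP Cx].
pose D := [set y in A | (x <= y)%O].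
have chCD : chain (C :|: D).
  apply/chainP => y z /setUP[yC | /setIdP[yA xy]] /setUP[zC | /setIdP[zA xz]].
  - exact: chC.
  - by apply: le_comparable; apply: le_trans (ltW (Cx _ yC)) xz.
  - by apply: ge_comparable; apply: le_trans (ltW (Cx _ zC)) xy.
  - exact: chA.
have [B flB /subset_leq_card] := chain_flag chCD.
have CD0 : C :&: D = set0.
  apply/setP => y; rewrite !inE; apply/negbTE/negP => /and3P[yC _ xy].
  by have := lt_le_trans (Cx _ yC) xy; rewrite ltxx.
rewrite (flag_size flB) -(flag_size flA) cardsU CD0 cards0 subn0.
rewrite -(cardsID [set y | (y < x)%O] A) -setIdE.
suff -> : A :\: [set y | (y < x)%O] = D by rewrite leq_add2r.
apply/setP=> y; rewrite !inE andbC; case yA: (y \in A) => //=.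
by rewrite -(comparable_leNgt (chA _ _ xA yA)).
Qed.

Lemma height_lt x y : (x < y)%O -> (height x < height y)%N.
Proof.
move=> xy; have [] := @chain_flag _ _ [set x; y].
  apply/chainP => u v /set2P[]-> /set2P[]->; rewrite ?comparablexx //.
    exact: lt_comparable.
  exact: gt_comparable.
move=> A flA; rewrite subUset !sub1set => /andP[xA yA].
rewrite !(height_flag flA) //; apply/proper_card/properP; split.
  by apply/subsetP=> z; rewrite !inE => /andP[-> /= /lt_trans->].
by exists x; rewrite !inE xA ?xy // ltxx.
Qed.

Lemma height_mono A : chain A ->
  {in A &, {mono @height d T : x y / (x <= y)%O >-> (x <= y)%N}}.
Proof.
move=> /chainP chA x y xA yA.
have [|/height_lt|->] := comparable_ltgtP (chA _ _ xA yA); rewrite ?leqnn //.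
  by move=> /height_lt/ltnW.
by move=> ltyx; rewrite leqNgt ltyx.
Qed.

Lemma height_inj A : chain A -> {in A &, injective (@height d T)}.
Proof.
move=> chA x y xA yA eq_h; apply/le_anti.
by rewrite -!(height_mono chA) // eq_h leqnn.
Qed.

Lemma height_bound x : (height x < n.+2)%N.
Proof.
have [A flA xA] := mem_flag x.
rewrite (height_flag flA xA) -(flag_size flA); apply/proper_card/properP.
split; first by apply/subsetP=> y; rewrite inE => /andP[].
by exists x; rewrite ?inE ?ltxx ?andbF.
Qed.

Definition face_at A h : T :=
  odflt \bot%O [pick x | (x \in A) && (height x == h)].

Lemma face_atP A h : flag A -> (h < n.+2)%N ->
  face_at A h \in A /\ height (face_at A h) = h.
Proof.
move=> flA lt_h; rewrite /face_at; case: pickP => [x /andP[xA /eqP] //|noface].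
pose f x : 'I_n.+2 := inord (height x).
have val_f x : f x = height x :> nat by rewrite inordK ?height_bound.
have card_f : #|f @: A| = n.+2.
  rewrite card_in_imset ?flag_size // => x y xA yA /(congr1 val) /=.
  by rewrite !val_f; apply: height_inj (flag_chain flA) _ _ xA yA.
have /eqP fA : f @: A == setT.
  by rewrite eqEcard subsetT card_f cardsT card_ord /=.
have : Ordinal lt_h \in f @: A by rewrite fA inE.
case/imsetP => x xA /(congr1 val); rewrite /= val_f => hE.
by have := noface x; rewrite xA -hE eqxx.
Qed.

Lemma mem_face_at A h : flag A -> (h < n.+2)%N -> face_at A h \in A.
Proof. by move=> flA /(face_atP flA)[]. Qed.

Lemma height_face_at A h : flag A -> (h < n.+2)%N -> height (face_at A h) = h.
Proof. by move=> flA /(face_atP flA)[]. Qed.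

Lemma face_at_height A x : flag A -> x \in A -> face_at A (height x) = x.
Proof.
move=> flA xA; have [fA hf] := face_atP flA (height_bound x).
exact: height_inj (flag_chain flA) _ _ fA xA hf.
Qed.

Lemma face_at_eq A B h : flag A -> flag B -> (h < n.+2)%N ->
  (face_at A h == face_at B h) = (face_at A h \in B).
Proof.
move=> flA flB lt_h; have [fA hA] := face_atP flA lt_h.
apply/eqP/idP => [->|fB]; first exact: mem_face_at.
by have := face_at_height flB fB; rewrite hA.
Qed.

Lemma face_at_lt A h k : flag A -> (h < k < n.+2)%N ->
  (face_at A h < face_at A k)%O.
Proof.
move=> flA /andP[hk kn]; have hn := ltn_trans hk kn.
have mono := height_mono (flag_chain flA).
by rewrite lt_leAnge -!mono ?mem_face_at ?height_face_at // -ltnNge hk ltnW.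
Qed.

Lemma eq_flags A B : flag A -> flag B ->
  (forall h, (h < n.+2)%N -> face_at A h = face_at B h) -> A = B.
Proof.
move=> flA flB eqAB; apply/eqP.
rewrite eqEcard !flag_size // leqnn andbT; apply/subsetP=> x xA.
rewrite -(face_at_height flA xA) eqAB ?height_bound //.
by rewrite mem_face_at ?height_bound.
Qed.

Lemma i_adjacentP i A B : (i < n)%N ->
  reflect [/\ flag A, flag B & forall h, (h < n.+2)%N ->
              (face_at A h == face_at B h) = (h != i.+1)]
          (i_adjacent i A B).
Proof.
move=> lt_in.
apply: (iffP and4P) => [[flA flB neqAB /eqP eqAB] | [flA flB eqAB]].
  have eq_off h : (h < n.+2)%N -> h != i.+1 -> face_at A h = face_at B h.
    move=> lt_h neq_h; apply/eqP; rewrite face_at_eq //.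
    have [fA hA] := face_atP flA lt_h.
    have : face_at A h \in [set x in A | height x != i.+1] by rewrite inE fA hA.
    by rewrite eqAB inE => /andP[].
  split=> // h lt_h; have [eq_h|/eq_off->//] := eqVneq h i.+1; last first.
    by rewrite eqxx.
  apply: contraNF neqAB => /eqP eqh; apply/eqP/eq_flags => // k lt_k.
  by have [-> | /eq_off->] := eqVneq k i.+1; rewrite -?eq_h.
have sub C D : flag C -> flag D ->
    (forall h, (h < n.+2)%N -> (face_at C h == face_at D h) = (h != i.+1)) ->
    [set x in C | height x != i.+1] \subset [set x in D | height x != i.+1].
  move=> flC flD eqCD; apply/subsetP => x; rewrite !inE => /andP[xC neq_x].
  rewrite neq_x andbT -(face_at_height flC xC) -face_at_eq ?height_bound //.
  by rewrite eqCD ?height_bound.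
split=> //.
  have lt_i : (i.+1 < n.+2)%N by lia.
  by apply/eqP => EAB; have := eqAB _ lt_i; rewrite EAB !eqxx.
by rewrite eqEsubset !sub // => h lt_h; rewrite eq_sym eqAB.
Qed.

Lemma flag_replace A u v : flag A -> u \in A -> v \notin A ->
  {in A :\ u, forall z, (z >=< v)%O} -> flag (v |: A :\ u).
Proof.
move=> flA uA vA cmp_v; rewrite flagE; apply/andP; split.
  apply/chainP => y z /setU1P[->|yAu] /setU1P[->|zAu].
  - exact: comparablexx.
  - by rewrite comparable_sym cmp_v.
  - exact: cmp_v.
  - move: yAu zAu => /setD1P[_ yA] /setD1P[_].
    exact: (chainP _ (flag_chain flA)).
rewrite cardsU1 !inE (negbTE vA) andbF /=.
by have := cardsD1 u A; rewrite uA flag_size // => ->.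
Qed.

Lemma between_comparable A x y v z : flag A -> x \in A -> y \in A -> z \in A ->
    height y = (height x).+2 -> (x < v < y)%O -> height z != (height x).+1 ->
  (z >=< v)%O.
Proof.
move=> flA xA yA zA hy /andP[xv vy] neq_z.
have mono := height_mono (flag_chain flA).
have [le_zx|lt_xz] := leqP (height z) (height x).
  by apply/le_comparable/(le_trans _ (ltW xv)); rewrite -mono.
by apply/ge_comparable/(le_trans (ltW vy)); rewrite -mono // hy; lia.
Qed.

Section Diamond.
Hypothesis diamondT : diamond T.

Lemma diamond_uniq x y u v w : height y = (height x).+2 ->
  (x < u < y)%O -> (x < v < y)%O -> (x < w < y)%O -> v != u -> w != u -> v = w.
Proof.
move=> hxy xuy xvy xwy neq_vu neq_wu.
have xy : (x < y)%O by case/andP: xuy; apply: lt_trans.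
have /eqP := diamondT xy hxy.
rewrite (cardsD1 u) inE xuy add1n eqSS => /cards1P[t Et].
have others z : (x < z < y)%O -> z != u -> z = t.
  by move=> xzy neq_z; apply/set1P; rewrite -Et !inE neq_z.
by rewrite (others v xvy neq_vu) (others w xwy neq_wu).
Qed.

Lemma adjacent_local i A C B D : (i < n)%N ->
    i_adjacent i A B -> i_adjacent i C D ->
    (forall h, (i <= h <= i.+2)%N -> face_at A h = face_at C h) ->
  face_at B i.+1 = face_at D i.+1.
Proof.
move=> lt_in; have [lt_i lt_i1] : (i < n.+2)%N /\ (i.+1 < n.+2)%N by lia.
move=> /(i_adjacentP _ _ lt_in)[flA flB adjAB].
move=> /(i_adjacentP _ _ lt_in)[flC flD adjCD] eqAC.
have faces E F : flag E -> flag F ->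
    (forall h, (h < n.+2)%N -> (face_at E h == face_at F h) = (h != i.+1)) ->
    (face_at E i < face_at F i.+1 < face_at E i.+2)%O /\
    face_at F i.+1 != face_at E i.+1.
  move=> flE flF adjEF; rewrite eq_sym adjEF // eqxx.
  have -> : face_at E i = face_at F i by apply/eqP; rewrite adjEF // ltn_eqF.
  have -> : face_at E i.+2 = face_at F i.+2.
    by apply/eqP; rewrite adjEF // eq_sym ltn_eqF.
  by rewrite !face_at_lt ?leqnn.
have [betweenB neqBA] := faces _ _ flA flB adjAB.
have [] := faces _ _ flC flD adjCD.
rewrite -!eqAC ?leqnn ?leqnSn ?leqW // => betweenD neqDA.
have hA : height (face_at A i.+2) = (height (face_at A i)).+2.
  by rewrite !height_face_at.
apply: (diamond_uniq hA _ betweenB betweenD neqBA neqDA).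
by rewrite !face_at_lt ?leqnn.
Qed.

Lemma adjacent_uniq i A B C : (i < n)%N ->
  i_adjacent i A B -> i_adjacent i A C -> B = C.
Proof.
move=> lt_in adjAB adjAC.
have eq_i := adjacent_local lt_in adjAB adjAC (fun _ _ => erefl).
move/(i_adjacentP _ _ lt_in): adjAB => [_ flB adjAB].
move/(i_adjacentP _ _ lt_in): adjAC => [_ flC adjAC].
apply: eq_flags => // h lt_h; have [-> //|neq_h] := eqVneq h i.+1.
have := adjAB h lt_h; have := adjAC h lt_h; rewrite neq_h.
by move=> /eqP <- /eqP <-.
Qed.

Lemma adjacent_ex i A : (i < n)%N -> flag A -> exists B, i_adjacent i A B.
Proof.
move=> lt_in flA; pose x := face_at A i; pose y := face_at A i.+2.
pose u := face_at A i.+1.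
have [xA hx] : x \in A /\ height x = i by apply: face_atP; lia.
have [yA hy] : y \in A /\ height y = i.+2 by apply: face_atP; lia.
have [uA hu] : u \in A /\ height u = i.+1 by apply: face_atP; lia.
have xuy : (x < u < y)%O by rewrite !face_at_lt //; lia.
have xy : (x < y)%O by case/andP: xuy; apply: lt_trans.
have hxy : height y = (height x).+2 by rewrite hx hy.
have /eqP := diamondT xy hxy; rewrite (cardsD1 u) inE xuy add1n eqSS.
case/cards1P => v /setP/(_ v); rewrite !inE eqxx => /andP[neq_vu xvy].
have hv : height v = i.+1.
  by case/andP: xvy => /height_lt + /height_lt; rewrite hx hy; lia.
have only_u z : z \in A -> height z = i.+1 -> z = u.
  by move=> zA hz; apply: (height_inj (flag_chain flA)); rewrite ?hz.
have vA : v \notin A by apply: contra neq_vu => /only_u->.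
have cmp_v : {in A :\ u, forall z, (z >=< v)%O}.
  move=> z /setD1P[neq_zu zA]; apply: (between_comparable flA xA yA) => //.
  by rewrite hx; apply: contraNneq neq_zu => /only_u->.
exists (v |: A :\ u); apply/and4P; split=> //; first exact: flag_replace.
  by apply: contraNneq vA => ->; rewrite setU11.
apply/eqP/setP => z; rewrite !inE.
have [-> |neq_zv] /= := eqVneq z v; first by rewrite hv eqxx !andbF.
by have [-> |//] := eqVneq z u; rewrite hu eqxx !andbF.
Qed.

End Diamond.
End RankedPoset.

(** * Rotations acting on a maniplex *)

Lemma mulg_index2 (gT : finGroupType) (G H : {group gT}) x y :
    H \subset G -> #|G : H| = 2 -> x \in G -> x \notin H -> y \in G ->
  (x * y \in H) = (y \notin H).
Proof.
move=> sHG indexHG Gx notHx Gy; have [Hy|notHy] := boolP (y \in H).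
  by rewrite groupMr // (negbTE notHx).
rewrite -groupV invMg -mem_rcoset (rcoset_index2 sHG) ?inE ?notHx //.
by rewrite !groupV notHy Gy.
Qed.

Section RotationGroup.
Variables (n : nat) (gT : finGroupType) (s : nat -> gT).

Lemma mem_rot_gen j : (0 < j < n)%N -> s j \in rot_group n s.
Proof.
move=> jn; have lt_jn : (j < n)%N by lia.
by apply/mem_gen/imsetP; exists (Ordinal lt_jn); rewrite // inE /=; lia.
Qed.

Lemma rot_group_sub (K : {group gT}) :
  (forall j, (0 < j < n)%N -> s j \in K) -> rot_group n s \subset K.
Proof.
move=> sK; rewrite gen_subG; apply/subsetP => g /imsetP[j].
by rewrite inE => j_gt0 ->; apply: sK; rewrite j_gt0 ltn_ord.
Qed.

Lemma rot_group_ind (P : gT -> Prop) :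
    P 1 -> (forall j g, (0 < j < n)%N -> P g -> P (s j * g)) ->
  {in rot_group n s, forall g, P g}.
Proof.
move=> P1 Ps g /gen_prodgP[m [c cs ->]]; elim: m c cs => [|m IHm] c cs.
  by rewrite big_ord0.
rewrite big_ord_recl; have /imsetP[j /[1!inE] j_gt0 ->] := cs ord0.
by apply: Ps; [rewrite j_gt0 ltn_ord | apply: IHm].
Qed.

Lemma kappa_in (K : {group gT}) a b :
  (forall j, (0 < j < n)%N -> s j \in K) -> kappa n s a b \in K.
Proof.
move=> sK; rewrite /kappa; case: ifP => // /andP[a_gt0 lt_bn].
rewrite big_seq; apply: group_prod => k; rewrite mem_index_iota => k_ab.
by apply: sK; lia.
Qed.

Lemma kappa_group_sub (K : {group gT}) (I : {set 'I_n.+2}) :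
  (forall j, (0 < j < n)%N -> s j \in K) -> kappa_group s I \subset K.
Proof.
move=> sK; rewrite gen_subG; apply/subsetP => _ /imset2P[a b _ _ ->].
exact: kappa_in.
Qed.

Lemma kappa_group_setT : kappa_group s [set: 'I_n.+2] = rot_group n s.
Proof.
apply/eqP; rewrite eqEsubset (@kappa_group_sub (rot_group_group n s)) /=.
  apply: (@rot_group_sub [group of kappa_group s _]) => j jn.
  have [lt_j lt_jS] : (j < n.+2)%N /\ (j.+1 < n.+2)%N by lia.
  apply/mem_gen/imset2P; exists (Ordinal lt_j) (Ordinal lt_jS).
  - by rewrite inE.
  - by rewrite !inE /=.
  by rewrite /= /kappa jn big_nat1.
exact: mem_rot_gen.
Qed.

End RotationGroup.

Lemma eq_rot_group n (gT : finGroupType) (s t : nat -> gT) :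
  (forall j, (0 < j < n)%N -> s j = t j) -> rot_group n s = rot_group n t.
Proof.
move=> eq_st; rewrite /rot_group; congr <<_>>; apply: eq_in_imset => j.
by rewrite inE => j_gt0; rewrite eq_st // j_gt0 ltn_ord.
Qed.

Lemma morphim_rot_group n (gT hT : finGroupType) (D : {group gT})
    (f : {morphism D >-> hT}) (s : nat -> gT) (t : nat -> hT) :
    (forall j, (0 < j < n)%N -> s j \in D /\ f (s j) = t j) ->
  f @* rot_group n s = rot_group n t.
Proof.
move=> fs; have sD : [set s (val i) | i : 'I_n & (0 < i)%N] \subset D.
  apply/subsetP => _ /imsetP[j /[1!inE] j_gt0 ->].
  by have [|] := fs j; rewrite ?j_gt0 ?ltn_ord.
rewrite -(@eq_rot_group _ _ (f \o s)) => [|j /fs[]//].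
by rewrite morphim_gen // morphimEsub // -imset_comp.
Qed.

Lemma isom_on_gens_inv n (gT hT : finGroupType) (D : {group gT})
    (f : {morphism D >-> hT}) (s : nat -> gT) :
    'injm f -> (forall j, (0 < j < n)%N -> s j \in D) ->
  isom_on_gens n (rot_group n (f \o s)) (f \o s) s.
Proof.
move=> injf sD; have sGD := rot_group_sub sD.
have injg := injm_restrm sGD injf.
have <- : restrm sGD f @* rot_group n s = rot_group n (f \o s).
  rewrite morphim_restrm setIid.
  by rewrite (morphim_rot_group (t := f \o s)) // => j /sD.
exists (invm_morphism injg).
  by apply/isomP; split; [exact: injm_invm | exact: im_invm].
by move=> j jn; rewrite /= (invmE injg) // mem_rot_gen.
Qed.

Section EquivariantAction.
Variables (n : nat) (X : finType) (r : 'I_n -> X -> X).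
Variables (gT : finGroupType) (D : {group gT}) (to : action D X).
Implicit Types (g : gT) (x y : X) (w : seq 'I_n) (I : pred 'I_n).

Definition equivariant := forall g i x, g \in D -> to (r i x) g = r i (to x g).

Definition rotations_at (s : nat -> gT) x := forall i j : 'I_n, i.+1 = j ->
  s j \in D /\ to x (s j) = r i (r j x).

Lemma rotations_at_in s x :
  rotations_at s x -> forall j : nat, (0 < j < n)%N -> s j \in D.
Proof.
move=> s_rot j jn; have [lt_in lt_jn] : (j.-1 < n)%N /\ (j < n)%N by lia.
by have [] := s_rot (Ordinal lt_in) (Ordinal lt_jn) _; rewrite //=; lia.
Qed.

Lemma rot_group_in s x : rotations_at s x -> rot_group n s \subset D.
Proof. by move=> s_rot; apply/rot_group_sub/(rotations_at_in s_rot). Qed.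

Hypothesis to_equiv : equivariant.

Lemma act_walk g w x : g \in D -> to (walk r w x) g = walk r w (to x g).
Proof. by move=> Dg; elim: w => //= i w IHw; rewrite to_equiv ?IHw. Qed.

Lemma act_linked g I x y :
  g \in D -> linked r I x y -> linked r I (to x g) (to y g).
Proof.
by move=> Dg /linkedP[w Iw <-]; rewrite act_walk //; apply: linked_walk.
Qed.

Hypothesis r_conn : connected_steps r.

Lemma colour_act (c : X -> bool) g x y : alternating r c -> g \in D ->
  (c (to x g) == c x) = (c (to y g) == c y).
Proof.
move=> c_alt Dg; have /linkedP[w _ <-] := r_conn x y.
by rewrite act_walk // !(colour_walk _ _ c_alt) (inj_eq (@addbI _)).
Qed.

Lemma colour_actV (c : X -> bool) g x y : alternating r c -> g \in D ->
  (c (to x g^-1) == c x) = (c (to y g) == c y).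
Proof.
move=> c_alt Dg; rewrite (colour_act _ (to y g) c_alt) ?groupV //.
by rewrite actKin // eq_sym.
Qed.

Hypothesis to_faithful : [faithful D, on [set: X] | to].

Lemma act_free g x : g \in D -> to x g = x -> g = 1.
Proof.
move=> Dg gx; apply/set1P/(subsetP to_faithful); rewrite !inE Dg /=.
apply/subsetP => y _; rewrite inE.
by have /linkedP[w _ <-] := r_conn x y; rewrite act_walk ?gx.
Qed.

Lemma act_free_inj x : {in D &, injective (to x)}.
Proof.
move=> g h Dg Dh eq_gh; apply/eqP; rewrite eq_mulgV1; apply/eqP/(@act_free _ x).
  by rewrite groupM ?groupV.
by rewrite actMin ?groupV // eq_gh actKin.
Qed.

End EquivariantAction.

Section RotaryAction.
Variables (n : nat) (M : maniplex n).
Variables (gT : finGroupType) (D : {group gT}) (to : action D M).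
Hypothesis to_equiv : equivariant (@step n M) to.
Variables (s : nat -> gT) (x0 : M).
Hypothesis s_rot : rotations_at (@step n M) to s x0.
Local Notation r := (@step n M).
Implicit Types (i j : 'I_n) (g : gT) (x y : M) (w : seq 'I_n).
Implicit Types I J : {set 'I_n.+2}.

Definition letters I : pred 'I_n := fun i => step_height i \in I.

Lemma kappa_group_in I : kappa_group s I \subset D.
Proof. exact/kappa_group_sub/(rotations_at_in s_rot). Qed.

Lemma maniplex_colour_act g x y : g \in D ->
  (colour (to x g) == colour x) = (colour (to y g) == colour y).
Proof.
exact: (colour_act to_equiv (@step_connected n M) x y (@colour_step n M)).
Qed.

Lemma colour_act_rotation i j x : i.+1 = j -> colour (to x (s j)) = colour x.
Proof.
move=> ij; have [sD act_s] := s_rot ij; apply/eqP.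
by rewrite (maniplex_colour_act x x0) // act_s !colour_step negbK.
Qed.

Lemma act_kappa i j : (i < j)%N -> to x0 (kappa n s i.+1 j) = r i (r j x0).
Proof.
rewrite /kappa ltn_ord /=; move: {2}(j - i) (erefl (j - i)) => e.
elim: e i => [|[|e] IHe] i eq_e lt_ij; first by lia.
  have ij : i.+1 = j by lia.
  by rewrite ij big_nat1; case: (s_rot ij).
have lt_iSn : (i.+1 < n)%N by have := ltn_ord j; lia.
have [sD act_s] := s_rot (i := i) (j := Ordinal lt_iSn) erefl.
have kappaD := kappa_in i.+2 j (rotations_at_in s_rot).
rewrite /kappa ltn_ord /= in kappaD.
rewrite big_ltn; last by lia.
rewrite actMin // act_s !to_equiv // (IHe (Ordinal lt_iSn)) /=; try lia.
by rewrite stepK.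
Qed.

Lemma act_kappa_pair I i j : letters I i -> letters I j ->
  exists2 k, k \in kappa_group s I & to x0 k = r i (r j x0).
Proof.
have gen_kappa (k l : 'I_n) : letters I k -> letters I l -> (k < l)%N ->
    kappa n s k.+1 l \in kappa_group s I.
  move=> Ik Il lt_kl; apply/mem_gen/imset2P.
  exists (step_height k) (step_height l) => //.
    by rewrite inE [_ \in I]Il !val_step_height.
  by rewrite /= !val_step_height.
move=> Ii Ij; have [lt_ij|lt_ji|/val_inj<-] := ltngtP i j.
- by exists (kappa n s i.+1 j); [apply: gen_kappa | apply: act_kappa].
- have kappaD := kappa_in j.+1 i (rotations_at_in s_rot).
  exists (kappa n s j.+1 i)^-1; first by rewrite groupV gen_kappa.
  apply: (act_inj to (kappa n s j.+1 i)).
  by rewrite actKVin // !to_equiv // act_kappa // !stepK.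
by exists 1; rewrite ?group1 // act1 stepK.
Qed.

Lemma act_even_walk I w : all (letters I) w -> ~~ odd (size w) ->
  exists2 k, k \in kappa_group s I & to x0 k = walk r w x0.
Proof.
have [N] := ubnP (size w); elim: N w => // N IHN [|i [|j w]] //= leN.
  by exists 1; rewrite ?group1 ?act1.
case/and3P => Ii Ij Iw; rewrite negbK => even_w.
have [k Ik act_k] := act_kappa_pair Ii Ij.
have [l Il act_l] := IHN w (ltnW leN) Iw even_w.
have /subsetP sub := kappa_group_in I.
exists (k * l); first by rewrite groupM.
by rewrite actMin ?sub // act_k !to_equiv ?sub ?act_l.
Qed.

Lemma kappa_linked I (a b : 'I_n.+2) : a \in I -> b \in I -> (a < b)%N ->
  let x := to x0 (kappa n s a b.-1) in
  (colour x == colour x0) && linked r (letters I) x0 x.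
Proof.
move=> Ia Ib lt_ab; have [a0|a_gt0] := posnP a.
  by rewrite /kappa a0 /= act1 eqxx linked_refl.
have [lt_bn|le_nb] := ltnP b.-1 n; last first.
  by rewrite /kappa (ltnNge b.-1) le_nb andbF /= act1 eqxx linked_refl.
have lt_an : (a.-1 < n)%N by lia.
have lt_pred : (a.-1 < b.-1)%N by lia.
have := @act_kappa (Ordinal lt_an) (Ordinal lt_bn) lt_pred.
rewrite /= prednK // => -> /=.
rewrite !colour_step negbK eqxx /=; apply: (@linked_walk _ _ _ _ [:: _; _]).
by rewrite /= /letters /step_height /= !prednK ?inord_val ?Ia ?Ib //; lia.
Qed.

Hypothesis to_faithful : [faithful D, on [set: M] | to].

Lemma mem_kappa_group I g : (g \in kappa_group s I) =
  [&& g \in D, colour (to x0 g) == colour x0 &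
      linked r (letters I) x0 (to x0 g)].
Proof.
apply/idP/and3P => [|[Dg /eqP same_colour /linkedP[w Iw wE]]]; last first.
  rewrite -wE in same_colour.
  have even_w := even_walk (@colour_step n M) same_colour.
  have [k Ik act_k] := act_even_walk Iw even_w.
  have Dk : k \in D := subsetP (kappa_group_in I) k Ik.
  suff eq_kg : to x0 k = to x0 g.
    by rewrite -(act_free_inj to_equiv (@step_connected n M) to_faithful
      Dk Dg eq_kg).
  by rewrite act_k.
pose K := [set g in D | (colour (to x0 g) == colour x0) &&
                        linked r (letters I) x0 (to x0 g)].
have groupK : group_set K.
  apply/group_setP; split; first by rewrite inE group1 act1 eqxx linked_refl.
  move=> k l /setIdP[Dk /andP[/eqP ck Ik]] /setIdP[Dl /andP[cl Il]].
  rewrite inE groupM //= actMin // -[X in _ == X]ck.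
  rewrite (maniplex_colour_act _ x0) // cl.
  exact: linked_trans Il (act_linked to_equiv Dl Ik).
suff /subsetP sub : kappa_group s I \subset Group groupK.
  by move=> /sub /setIdP[Dg /andP[]].
rewrite gen_subG; apply/subsetP => _ /imset2P[a b Ia /setIdP[Ib lt_ab] ->].
by rewrite inE (kappa_in _ _ (rotations_at_in s_rot)); apply: kappa_linked.
Qed.

Lemma rotary_intersection_property : intersection_property n s.
Proof.
move=> I J; apply/setP => g; rewrite in_setI !mem_kappa_group.
apply/andP/and3P => [[/and3P[Dg cg Ig] /and3P[_ _ Jg]]|[Dg cg IJg]].
  split=> //; apply: linked_sub (step_intersection Ig Jg) => i.
  by rewrite /letters /= inE.
by split; apply/and3P; split=> //; apply: linked_sub IJg => i;
  rewrite /letters /= inE => /andP[].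
Qed.

Lemma mem_rot_group g :
  (g \in rot_group n s) = (g \in D) && (colour (to x0 g) == colour x0).
Proof.
rewrite -kappa_group_setT mem_kappa_group; congr andb.
have /linked_sub-> := step_connected x0 (to x0 g); first by rewrite andbT.
by move=> i _; rewrite /letters inE.
Qed.

Lemma orbit_rot_group x y :
  (y \in orbit to (rot_group n s) x) = (colour y == colour x).
Proof.
have sub := subsetP (rot_group_in s_rot); apply/orbitP/eqP => [[g sg <-]|].
  apply/eqP; rewrite (maniplex_colour_act x x0) ?sub //.
  by move: sg; rewrite mem_rot_group => /andP[].
have from_base z : colour z = colour x0 ->
    exists2 g, g \in rot_group n s & to x0 g = z.
  have /linkedP[w _ <-] := step_connected x0 z => same_colour.
  rewrite -kappa_group_setT; apply: (act_even_walk _ (even_walk _ same_colour)).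
    by apply/allP => i _; rewrite /letters inE.
  exact: colour_step.
have from_same_colour u v : colour u = colour x0 -> colour v = colour u ->
    exists2 g, g \in rot_group n s & to u g = v.
  move=> cu cv; have [g sg <-] := from_base u cu.
  have [h sh <-] := from_base v (etrans cv cu).
  exists (g^-1 * h); first by rewrite groupM ?groupV.
  by rewrite actMin ?groupV ?sub // actKin ?sub.
move=> same_colour; have [cx|neq_cx] := eqVneq (colour x) (colour x0).
  exact: from_same_colour.
have /linkedP[[|i w] _ xE] := step_connected x0 x.
  by rewrite -xE eqxx in neq_cx.
have cix := alternating_step i (@colour_step n M) neq_cx.
have [|g sg gE] := from_same_colour (step i x) (step i y) cix.
  by rewrite !colour_step same_colour.
by exists g; rewrite // -[y](stepK i) -gE to_equiv ?stepK // sub.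
Qed.

Lemma index_rot_group g : g \in D -> colour (to x0 g) != colour x0 ->
  #|D : rot_group n s| = 2.
Proof.
move=> Dg cg; pose H := rot_group_group n s.
have notHg : g \notin H by rewrite mem_rot_group Dg.
have neq_Hg : gval H != H :* g.
  by apply: contraNneq notHg => ->; apply: rcoset_refl.
suff -> : #|D : H| = #|[set gval H; H :* g]| by rewrite cards2 neq_Hg.
congr #|pred_of_set _|; apply/setP => A.
apply/rcosetsP/set2P => [[h Dh ->]|[]->]; last 2 first.
- by exists 1; rewrite ?group1 // mulg1.
- by exists g.
have [Hh|notHh] := boolP (h \in H); first by left; apply: rcoset_id.
right; apply/rcoset_eqP; rewrite mem_rcoset mem_rot_group groupM ?groupV //=.
have := colour_actV to_equiv (@step_connected n M) (to x0 h) x0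
  (@colour_step n M) Dg.
rewrite actMin ?groupV // (negbTE cg); move: notHh; rewrite mem_rot_group Dh /=.
by case: (colour (to (to x0 h) _)) (colour (to x0 h)) (colour x0) => [] [] [].
Qed.

Lemma rot_group_normal : rot_group n s <| D.
Proof.
have [|no_rev] := boolP [exists g in D, colour (to x0 g) != colour x0].
  case/exists_inP=> g Dg cg.
  exact: index2_normal (rot_group_in s_rot) (index_rot_group Dg cg).
suff -> : rot_group n s = D by apply: normal_refl.
apply/setP => g; rewrite mem_rot_group; case: (boolP (g \in D)) => //= Dg.
by apply: contraNT no_rev => cg; apply/exists_inP; exists g.
Qed.

Lemma eq_iter_rotation i j m k : i.+1 = j -> s j ^+ m = s j ^+ k ->
  iter m (r i \o r j) =1 iter k (r i \o r j).
Proof.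
move=> ij eq_sj; have [sD act_s] := s_rot ij.
have iter_act l g : g \in D ->
    iter l (r i \o r j) (to x0 g) = to x0 (s j ^+ l * g).
  move=> Dg; elim: l => [|l IHl]; first by rewrite expg0 mul1g.
  have Dl : s j ^+ l * g \in D by rewrite groupM ?groupX.
  by rewrite iterS IHl expgS -mulgA (actMin to x0 sD Dl) act_s !to_equiv.
have eq_iter x : colour x = colour x0 ->
    iter m (r i \o r j) x = iter k (r i \o r j) x.
  move/eqP; rewrite -orbit_rot_group => /orbitP[g sg <-].
  by rewrite !iter_act ?eq_sj // (subsetP (rot_group_in s_rot)).
have colour_iter l x : colour (iter l (r i \o r j) x) = colour x.
  by elim: l => //= l IHl; rewrite !colour_step negbK.
move=> x; have [/eq_iter//|neq_cx] := eqVneq (colour x) (colour x0).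
pose y := r j (iter k (r i \o r j) x).
have cy : colour y = colour x0.
  by apply: alternating_step; rewrite ?colour_iter //; apply: colour_step.
have iter_y : iter m (r i \o r j) y = r j x.
  by rewrite eq_iter // iter_rotation_rev //; apply: stepK.
by have := iter_rotation_rev (@stepK n M) i j m y; rewrite iter_y !stepK.
Qed.

End RotaryAction.

(** * The flag graph of a polytope *)

Definition flag_of d (T : finTBPOrderType d) := {A : {set T} | flag A}.
Arguments flag_of {d} T.

Definition adj {n d} {T : finTBPOrderType d} (i : 'I_n) (x : flag_of T) :=
  odflt x [pick y : flag_of T | i_adjacent i (val x) (val y)].

Section FlagAction.
Variables (d : Order.disp_t) (T : finTBPOrderType d).
Implicit Types (x y : flag_of T) (g : {perm T}).

Fact autgrp_acts_on_flags : autgrp T \subset subact_dom (@flag d T) 'P^*.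
Proof.
apply/subsetP => g autg; rewrite !inE; apply/subsetP => A.
by rewrite !inE; apply: aut_flag.
Qed.

Definition flag_action : action (autgrp T) (flag_of T) :=
  (('P^*)^? \ autgrp_acts_on_flags)%act.

Lemma val_flag_action x g :
  g \in autgrp T -> val (flag_action x g) = g @: val x.
Proof.
by move=> autg; rewrite /= val_subact (subsetP autgrp_acts_on_flags).
Qed.

Lemma orbit_flag_action x y :
  (val y \in orbit 'P^* (autgrp T) (val x)) =
  (y \in orbit flag_action (autgrp T) x).
Proof.
apply/orbitP/orbitP => -[g autg gxy]; exists g => //.
  by apply: val_inj; rewrite val_flag_action.
by rewrite -gxy val_flag_action.
Qed.

Lemma regularP x :
  regular T <-> forall y, y \in orbit flag_action (autgrp T) x.
Proof.
have flx : val x \in flags T by rewrite inE; apply: valP.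
split=> [regT y | flags_x].
  by rewrite -orbit_flag_action (atransP regT) // inE; apply: valP.
apply/imsetP; exists (val x) => //; apply/setP => A; rewrite inE.
apply/idP/orbitP => [flA | [g autg <-]].
  apply/orbitP; rewrite -[A]/(val (exist _ A flA : flag_of T)).
  by rewrite orbit_flag_action.
by have := valP (flag_action x g); rewrite val_flag_action.
Qed.

End FlagAction.

Section FlagGraph.
Variables (n : nat) (d : Order.disp_t) (T : finTBPOrderType d).
Hypothesis polyT : is_polytope n T.
Implicit Types (i j : 'I_n) (w v : seq 'I_n) (I : pred 'I_n).
Implicit Types (A B : {set T}) (x y z : flag_of T).
Local Notation r := (@adj n d T).

Let flag_size : flags_have_size n T. Proof. by case: polyT. Qed.
Let diamondT : diamond T. Proof. by case: polyT. Qed.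

Lemma adjP i x : i_adjacent i (val x) (val (adj i x)).
Proof.
rewrite /adj; case: pickP => //= no_adj.
have [B adjB] := adjacent_ex flag_size diamondT (ltn_ord i) (valP x).
have flB : flag B by case/and4P: adjB.
by have := no_adj (exist _ B flB); rewrite /= adjB.
Qed.

Lemma adj_uniq i x y : i_adjacent i (val x) (val y) -> adj i x = y.
Proof.
move=> adj_xy; apply/val_inj.
exact: (adjacent_uniq flag_size diamondT (ltn_ord i) (adjP i x)).
Qed.

Lemma face_adj i x h : (h < n.+2)%N ->
  (face_at (val x) h == face_at (val (adj i x)) h) = (h != i.+1).
Proof.
by have /(i_adjacentP flag_size _ _ (ltn_ord i))[_ _] := adjP i x; apply.
Qed.

Lemma face_adj_avoiding i x h : (h < n.+2)%N -> avoiding h i ->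
  face_at (val (adj i x)) h = face_at (val x) h.
Proof. by move=> lt_h avoids; apply/esym/eqP; rewrite face_adj // eq_sym. Qed.

Lemma adjK : involutive_steps r.
Proof. by move=> i x; apply: adj_uniq; rewrite i_adjacent_sym adjP. Qed.

Lemma adjC : far_commuting r.
Proof.
move=> i j x far_ij; apply/esym/adj_uniq; apply/(i_adjacentP flag_size) => //.
split=> [||h lt_h]; try exact: valP.
have [->|neq_hj] := eqVneq h j.+1.
  have lt_j : (j.+1 < n.+2)%N by have := ltn_ord j; lia.
  have avoids : avoiding j.+1 i by move: far_ij; rewrite /far /avoiding; lia.
  by rewrite !(face_adj_avoiding _ lt_j avoids) face_adj // eqxx.
apply/eqP; have [->|neq_hi] := eqVneq h i.+1; last first.
  by rewrite !face_adj_avoiding // /avoiding eq_sym.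
apply: (adjacent_local flag_size diamondT (ltn_ord i) (adjP i x)
  (adjP i (adj j x))) => k le_k.
rewrite face_adj_avoiding //; first by have := ltn_ord i; lia.
by move: far_ij; rewrite /far /avoiding; lia.
Qed.

Lemma connect_linked (D : {set T}) x y :
    connect [rel A B : {set T} | [&& D \subset A, D \subset B &
                [exists i : 'I_n, i_adjacent i A B]]] (val x) (val y) ->
  linked r (fun i => [forall z in D, height z != i.+1]) x y.
Proof.
case/connectP=> p; elim: p x => [|B p IHp] x /= => [_ /val_inj->|].
  exact: linked_refl.
case/andP=> /and3P[Dx DB /existsP[i adj_xB]] p_path y_last.
have flB : flag B by case/and4P: adj_xB.
have adjE : adj i x = exist _ B flB by apply: adj_uniq.
apply: linked_trans (IHp (exist _ B flB) p_path y_last).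
rewrite -adjE; apply: linked_step; apply/forall_inP => z Dz; apply: contraT.
rewrite negbK => /eqP hz; have lt_i : (i.+1 < n.+2)%N by have := ltn_ord i; lia.
have := face_adj i x lt_i; rewrite eqxx adjE -hz.
rewrite !(face_at_height flag_size) ?eqxx ?(valP x) ?(subsetP Dx) //.
exact: (subsetP DB).
Qed.

Lemma adj_linkedP I x y :
  reflect (forall i, ~~ I i -> face_at (val x) i.+1 = face_at (val y) i.+1)
          (linked r I x y).
Proof.
have lt_i i : (i.+1 < n.+2)%N by have := ltn_ord i; lia.
apply: (iffP idP) => [/linkedP[w Iw <-] i notIi | eq_xy].
  elim: w Iw => //= j w IHw /andP[Ij /IHw->]; rewrite face_adj_avoiding //.
  by rewrite /avoiding eqSS; apply: contraNneq notIi => /val_inj <-.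
have [_ connT _] := polyT.
have := connect_linked (connT _ _ (valP x) (valP y)).
apply: linked_sub => i /forall_inP height_i; apply: contraT => notIi.
have /height_i : face_at (val x) i.+1 \in val x :&: val y.
  by rewrite inE {2}(eq_xy i notIi) !(mem_face_at flag_size) //; apply: valP.
by rewrite (height_face_at flag_size) ?eqxx ?(valP x).
Qed.

Lemma adj_connected : connected_steps r.
Proof. by move=> x y; apply/adj_linkedP. Qed.

Lemma adj_path_intersection : path_intersection r.
Proof.
move=> I J x y /adj_linkedP Ixy /adj_linkedP Jxy; apply/adj_linkedP => i /=.
by rewrite negb_and => /orP[/Ixy|/Jxy].
Qed.

Lemma flag_action_adj : equivariant r (flag_action T).
Proof.
move=> g i x autg; apply/esym/adj_uniq; rewrite !val_flag_action //.
exact: aut_adjacent (adjP i x).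
Qed.

Lemma flag_action_faithful :
  [faithful autgrp T, on [set: flag_of T] | flag_action T].
Proof.
apply/subsetP => g /setIP[autg /setIP[_ fix_g]]; apply/set1P/permP => z.
rewrite perm1.
have [A flA zA] := mem_flag z; pose x : flag_of T := exist _ A flA.
have gA : g @: A = A.
  move: fix_g; rewrite inE => /subsetP/(_ x (in_setT x)) /[1!inE]/eqP gx.
  by rewrite -[A]/(val x) -val_flag_action // gx.
apply: (height_inj flag_size (flag_chain flA)) => //; last exact: aut_height.
by have := imset_f g zA; rewrite gA.
Qed.

Lemma flag_action_inj x : {in autgrp T &, injective (flag_action T x)}.
Proof.
exact: (act_free_inj flag_action_adj adj_connected flag_action_faithful).
Qed.

Definition flag_maniplex c (c_alt : alternating r c) x : maniplex n :=
  Maniplex adjK adjC c_alt adj_connected adj_path_intersection x.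

Definition flag_rotations s x := rotations_at r (flag_action T) s x.

Lemma chiral_rotationsP s x :
  chiral_rotations n (val x) s <-> flag_rotations s x.
Proof.
split=> [rot_s i j ij | rot_s j jn].
  have [|aut_s [B adjB adj_s]] := rot_s j; first by have := ltn_ord j; lia.
  have flB : flag B by case/and4P: adjB.
  split=> //; have -> : adj j x = exist _ B flB by apply: adj_uniq.
  by apply/esym/adj_uniq; rewrite val_flag_action //= -[i : nat]/(i.+1.-1) ij.
have [lt_in lt_jn] : (j.-1 < n)%N /\ (j < n)%N by lia.
have ij : (Ordinal lt_in).+1 = Ordinal lt_jn by rewrite /=; lia.
have [aut_s act_s] := rot_s _ _ ij; split=> //.
exists (val (adj (Ordinal lt_jn) x)); first exact: (adjP (Ordinal lt_jn)).
by rewrite -val_flag_action // act_s; apply: (adjP (Ordinal lt_in)).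
Qed.

Section Reflections.
Variables (rho : nat -> {perm T}) (x : flag_of T).
Hypothesis refl_rho : reflections n (val x) rho.

Lemma reflectionP i : rho i \in autgrp T /\ flag_action T x (rho i) = adj i x.
Proof.
have [aut_i adj_i] := refl_rho (ltn_ord i).
by split=> //; apply/esym/adj_uniq; rewrite val_flag_action.
Qed.

Lemma prod_reflections w : \prod_(i <- w) rho i \in autgrp T /\
  flag_action T x (\prod_(i <- w) rho i) = walk r w x.
Proof.
elim: w => [|i w [aut_w act_w]]; first by rewrite big_nil group1 act1.
have [aut_i act_i] := reflectionP i.
by rewrite big_cons groupM // actMin // act_i flag_action_adj // act_w.
Qed.

Lemma prod_reflections_eq w v : walk r w x = walk r v x ->
  \prod_(i <- w) rho i = \prod_(i <- v) rho i.
Proof.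
have [[aut_w <-] [aut_v <-]] := (prod_reflections w, prod_reflections v).
exact: flag_action_inj.
Qed.

Lemma autgrp_prod_reflections g : g \in autgrp T ->
  exists w : seq 'I_n, g = \prod_(i <- w) rho i.
Proof.
move=> autg; have /linkedP[w _ wE] := adj_connected x (flag_action T x g).
have [aut_w act_w] := prod_reflections w.
by exists w; apply: (flag_action_inj (x := x)); rewrite // act_w.
Qed.

Lemma rot_of_flag_rotations : flag_rotations (rot_of rho) x.
Proof.
move=> i j ij; have -> : rot_of rho j = \prod_(k <- [:: i; j]) rho k.
  by rewrite /rot_of -ij /= !big_cons big_nil mulg1 ij.
exact: prod_reflections [:: i; j].
Qed.

End Reflections.

Lemma regular_flag_rotations t x :
  regular_rotations n (val x) t -> flag_rotations t x.
Proof.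
case=> rho refl_rho t_rho i j ij.
by rewrite t_rho; [apply: rot_of_flag_rotations | have := ltn_ord j; lia].
Qed.

Lemma regular_reflections x :
  regular T -> exists rho, reflections n (val x) rho.
Proof.
move=> /(regularP x) regT.
have /fin_all_exists[f f_refl] i : exists g,
    g \in autgrp T /\ flag_action T x g = adj i x.
  by have /orbitP[g] := regT (adj i x); exists g.
exists (fun k => if insub k is Some i then f i else 1) => k lt_kn.
have [aut_f act_f] := f_refl (Ordinal lt_kn); rewrite insubT; split=> //.
by rewrite -val_flag_action // act_f; apply: (adjP (Ordinal lt_kn)).
Qed.

Lemma chiral_colour x : chiral n T ->
  alternating r (fun y => y \in orbit (flag_action T) (autgrp T) x).
Proof.
case=> orb2 adj_orb i y; pose orb z := orbit 'P^* (autgrp T) (val z).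
have := adj_orb _ _ _ (adjP i y).
rewrite -!orbit_flag_action -!orbit_eq_mem -!/(orb _).
have orb_in z : orb z \in [set orbit 'P^* (autgrp T) A | A in flags T].
  by apply: imset_f; rewrite inE (valP z).
move: (orb_in x) (orb_in y) (orb_in (adj i y)).
have /eqP/cards2P[O [O' [neq_O ->]]] := orb2.
by rewrite !inE => /orP[]/eqP-> /orP[]/eqP-> /orP[]/eqP->;
  rewrite ?eqxx // ?(eq_sym O') ?(negbTE neq_O).
Qed.

Lemma directly_regular_colour : directly_regular n T ->
  exists c : flag_of T -> bool, alternating r c.
Proof.
case=> regT [Phi [rho [flPhi refl_rho index2]]].
pose x : flag_of T := exist _ Phi flPhi.
pose H := rot_group_group n (rot_of rho).
have {}refl_rho : reflections n (val x) rho by [].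
have rho_aut i : rho i \in autgrp T by have [] := reflectionP refl_rho i.
have sH : H \subset autgrp T.
  exact: rot_group_in (rot_of_flag_rotations refl_rho).
have rho_H k : (k < n)%N -> (rho k \in H) = (rho 0 \in H).
  elim: k => // k IHk lt_kn; rewrite -IHk; last exact: ltnW.
  have rotH : rot_of rho k.+1 \in H by apply: mem_rot_gen.
  apply/idP/idP => rhoH; first by move: rotH; rewrite groupMr.
  by move: rotH; rewrite groupMl.
have rho_notH i : rho i \notin H.
  rewrite rho_H //; apply/negP => rho0H.
  suff : autgrp T \subset H by rewrite -indexg_eq1 index2.
  apply/subsetP => _ /(autgrp_prod_reflections refl_rho)[w ->].
  by apply: group_prod => i' _; rewrite rho_H.
exists (fun y => y \in orbit (flag_action T) H x) => i y.
have mem_orbit_H g : g \in autgrp T ->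
    (flag_action T x g \in orbit (flag_action T) H x) = (g \in H).
  move=> autg; apply/orbitP/idP => [[h Hh hg]|Hg]; last by exists g.
  by rewrite -(flag_action_inj _ autg hg) // (subsetP sH).
have /orbitP[g autg <-] := (regularP x).1 regT y.
have [_ act_i] := reflectionP refl_rho i.
rewrite -flag_action_adj // -act_i -actMin // (mem_orbit_H _ autg).
rewrite mem_orbit_H; last by rewrite (@groupM _ (autgrp_group T)).
exact: (@mulg_index2 _ (autgrp_group T)).
Qed.

End FlagGraph.

Section RotaryPolytope.
Variables (n : nat) (d : Order.disp_t) (T : finTBPOrderType d).
Hypotheses (n_gt0 : (0 < n)%N) (polyT : is_polytope n T).
Variable c : flag_of T -> bool.
Hypothesis c_alt : alternating (@adj n d T) c.
Variables (s : nat -> {perm T}) (x0 : flag_of T).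
Hypothesis s_rot : flag_rotations n s x0.
Implicit Types (g : {perm T}) (x y : flag_of T).
Local Notation M := (flag_maniplex polyT c_alt x0).

Let act_equiv : equivariant (@step n M) (flag_action T).
Proof. exact: (flag_action_adj polyT). Qed.

Let act_faithful : [faithful autgrp T, on [set: M] | flag_action T].
Proof. exact: (flag_action_faithful polyT). Qed.

Lemma mem_rot_group_colour g :
  (g \in rot_group n s) = (g \in autgrp T) && (c (flag_action T x0 g) == c x0).
Proof. exact: (mem_rot_group act_equiv s_rot act_faithful). Qed.

Lemma rot_group_normal_colour : rot_group n s <| autgrp T.
Proof. exact: (rot_group_normal act_equiv s_rot act_faithful). Qed.

Lemma orbit_rot_group_colour x y :
  (y \in orbit (flag_action T) (rot_group n s) x) = (c y == c x).
Proof. exact: (orbit_rot_group act_equiv s_rot act_faithful). Qed.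

Lemma chiral_of_preserved_colour :
    {in autgrp T, forall g, c (flag_action T x0 g) = c x0} ->
  [/\ chiral n T, chiral_rotations n (val x0) s & autgrp T = rot_group n s].
Proof.
move=> c_aut; have autE : autgrp T = rot_group n s.
  apply/setP => g; rewrite mem_rot_group_colour.
  by case: (boolP (g \in _)) => // /c_aut->; rewrite eqxx.
split=> //; last exact/(chiral_rotationsP polyT).
pose orb (x : flag_of T) := orbit 'P^* (autgrp T) (val x).
have mem_orb x y : (val y \in orb x) = (c y == c x).
  by rewrite orbit_flag_action -orbit_rot_group_colour -autE.
have orbE x y : (orb y == orb x) = (c y == c x) by rewrite orbit_eq_mem mem_orb.
pose i0 := Ordinal n_gt0; split=> [|i A B adjAB].
  suff -> : orbit 'P^* (autgrp T) @: flags T = [set orb x0; orb (adj i0 x0)].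
    by rewrite cards2 orbE c_alt; case: (c x0).
  apply/setP => A; apply/imsetP/set2P => [[B /[!inE] flB ->]|[]->].
  - have [/eqP|neq_c] := eqVneq (c (exist _ B flB)) (c x0).
      by rewrite -orbE => /eqP; left.
    right; apply/eqP; rewrite -[B]/(val (exist _ B flB : flag_of T)) orbE c_alt.
    by case: (c _) (c x0) neq_c => [] [].
  - by exists (val x0); rewrite // inE; apply: valP.
  - by exists (val (adj i0 x0)); rewrite // inE; apply: valP.
have [flA flB] : flag A /\ flag B by case/and4P: adjAB.
pose x : flag_of T := exist _ A flA; pose y : flag_of T := exist _ B flB.
have adj_xy : adj i x = y by apply: (adj_uniq polyT).
rewrite -[A]/(val x) -[B]/(val y) -adj_xy [_ \in _]mem_orb c_alt.
by case: (c x).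
Qed.

Lemma directly_regular_of_reversed_colour g0 : g0 \in autgrp T ->
    c (flag_action T x0 g0) != c x0 ->
  directly_regular n T /\ regular_rotations n (val x0) s.
Proof.
move=> autg0 cg0; have sub := subsetP (rot_group_in s_rot).
have regT : regular T.
  apply/(regularP x0) => y.
  have [/eqP|neq_c] := eqVneq (c y) (c x0).
    rewrite -orbit_rot_group_colour => /orbitP[g /sub autg <-].
    exact: mem_orbit.
  have : c y == c (flag_action T x0 g0).
    by move: neq_c cg0; case: c (c _) (c x0) => [] [] [].
  rewrite -orbit_rot_group_colour => /orbitP[g /sub autg <-].
  by rewrite -actMin // mem_orbit // groupM.
have [rho refl_rho] := regular_reflections polyT x0 regT.
have rho_rot := rot_of_flag_rotations polyT refl_rho.
have sE j : (0 < j < n)%N -> s j = rot_of rho j.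
  move=> jn; have [lt_in lt_jn] : (j.-1 < n)%N /\ (j < n)%N by lia.
  have ij : (Ordinal lt_in).+1 = Ordinal lt_jn by rewrite /=; lia.
  have [[aut_s act_s] [aut_rho act_rho]] := (s_rot ij, rho_rot _ _ ij).
  by apply: (flag_action_inj polyT (x := x0)) => //; rewrite act_s act_rho.
split; last by exists rho.
split=> //; exists (val x0), rho; split=> //; first exact: valP.
rewrite -(eq_rot_group sE).
exact: (index_rot_group act_equiv s_rot act_faithful autg0 cg0).
Qed.

Lemma chiral_or_directly_regular :
  [/\ chiral n T, chiral_rotations n (val x0) s & autgrp T = rot_group n s] \/
  directly_regular n T /\ regular_rotations n (val x0) s.
Proof.
have [c_aut|] := boolP [forall g in autgrp T, c (flag_action T x0 g) == c x0].
  by left; apply: chiral_of_preserved_colour => g /(forall_inP c_aut)/eqP.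
case/forall_inPn=> g autg cg; right.
exact: directly_regular_of_reversed_colour autg cg.
Qed.

End RotaryPolytope.

Lemma chiral_autgrp n d (T : finTBPOrderType d) (s : nat -> {perm T})
    (x0 : flag_of T) :
    is_polytope n T -> chiral n T -> flag_rotations n s x0 ->
  autgrp T = rot_group n s.
Proof.
move=> polyT chiT s_rot; apply/setP => g.
rewrite (mem_rot_group_colour polyT (chiral_colour polyT x0 chiT) s_rot).
by case: (boolP (g \in _)) => //= autg; rewrite mem_orbit // orbit_refl.
Qed.

(** * The polytope of a maniplex *)

Section FacePoset.
Variables (n : nat) (M : maniplex n).
Local Notation r := (@step n M).
Implicit Types (x y : M) (h : 'I_n.+2) (i j : 'I_n) (w : seq 'I_n).

Definition residue (h : nat) x : {set M} := [set y | linked r (avoiding h) x y].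

Lemma mem_residue h x y : (y \in residue h x) = (residue h x == residue h y).
Proof.
have symM := linked_sym (@stepK n M).
apply/idP/eqP => [|eq_xy]; last first.
  by rewrite eq_xy inE linked_refl.
rewrite inE => xy; apply/setP => z; rewrite !inE.
by apply/idP/idP; apply: linked_trans => //; apply: symM.
Qed.

(* Different ranks may give the same residue, so a face records its height. *)
Definition face := {z : 'I_n.+2 * {set M} | [exists x, z.2 == residue z.1 x]}.
HB.instance Definition _ := Finite.on face.

Implicit Types z : face.
Definition face_height z : 'I_n.+2 := (val z).1.
Definition face_flags z : {set M} := (val z).2.

Fact face_of_subproof h x :
  [exists y, (h, residue h x).2 == residue (h, residue h x).1 y].
Proof. by apply/existsP; exists x. Qed.

Definition face_of h x : face :=
  exist _ (h, residue h x) (face_of_subproof h x).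

Lemma face_of_eq h x y :
  (face_of h x == face_of h y) = linked r (avoiding h) x y.
Proof. by rewrite -val_eqE /= xpair_eqE eqxx -mem_residue inE. Qed.

Lemma face_of_inj x : injective (face_of^~ x).
Proof. by move=> h k /(congr1 face_height). Qed.

Lemma face_flagsP z x :
  reflect (z = face_of (face_height z) x) (x \in face_flags z).
Proof.
apply: (iffP idP) => [|->]; last by rewrite inE linked_refl.
have /existsP[y /eqP zy] := valP z.
rewrite /face_flags zy mem_residue -zy => /eqP zx.
by apply: val_inj; rewrite /= -zx -surjective_pairing.
Qed.

Lemma face_flags_neq0 z : exists x, x \in face_flags z.
Proof.
have /existsP[x /eqP zx] := valP z; exists x.
by rewrite /face_flags zx inE linked_refl.
Qed.

Lemma face_flags_linked z x y : x \in face_flags z ->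
  (y \in face_flags z) = linked r (avoiding (face_height z)) x y.
Proof. by move=> /face_flagsP ->; rewrite inE. Qed.

Lemma face_flags_walk z w x : all (avoiding (face_height z)) w ->
  (walk r w x \in face_flags z) = (x \in face_flags z).
Proof.
move=> zw; have zx := linked_walk r x zw.
apply/idP/idP => mem_z; rewrite (face_flags_linked _ mem_z) //.
exact: linked_sym (@stepK n M) _ _ _ zx.
Qed.

Definition face_le z z' := (face_height z <= face_height z')%N &&
  [exists x, (x \in face_flags z) && (x \in face_flags z')].

Lemma face_leP z z' :
  reflect ((face_height z <= face_height z')%N /\
           exists x, x \in face_flags z /\ x \in face_flags z')
          (face_le z z').
Proof.
apply: (iffP andP) => -[le_h].
  by case/existsP=> x /andP[xz xz']; split=> //; exists x.
by case=> x [xz xz']; split=> //; apply/existsP; exists x; rewrite xz.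
Qed.

Lemma below_avoiding (k l : nat) :
  (k <= l)%N -> subpred (@below n k) (avoiding l).
Proof. by move=> le_kl i; rewrite /below /avoiding; lia. Qed.

Lemma above_avoiding (k l : nat) :
  (l <= k)%N -> subpred (@above n k) (avoiding l).
Proof. by move=> le_lk i; rewrite /above /avoiding; lia. Qed.

(* In a walk from x to a flag through both faces, the letters above z' can be
   dropped, because they leave z unchanged. *)
Lemma face_le_below z z' x : face_le z z' -> x \in face_flags z' ->
  exists2 w, all (below (face_height z')) w & walk r w x \in face_flags z.
Proof.
case/face_leP=> le_h [y [yz yz']] xz'.
have /linkedP[w z'w wE] : linked r (avoiding (face_height z')) x y.
  by rewrite -face_flags_linked.
exists (filter (below (face_height z')) w); first exact: filter_all.
rewrite -(@face_flags_walk _ (filter (above (face_height z')) w)).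
  by rewrite -walk_above_below ?wE //; apply: stepC.
by apply: sub_all (filter_all _ _); apply: above_avoiding.
Qed.

Lemma face_le_refl : reflexive face_le.
Proof.
move=> z; have [x xz] := face_flags_neq0 z.
by apply/face_leP; split; last exists x.
Qed.

Lemma face_le_anti : antisymmetric face_le.
Proof.
move=> z z' /andP[/face_leP[le_zz' [x [xz xz']]] /face_leP[le_z'z _]].
have eq_h : face_height z = face_height z'.
  by apply/val_inj/eqP; rewrite eqn_leq le_zz'.
by move: xz xz' => /face_flagsP-> /face_flagsP->; rewrite eq_h.
Qed.

Lemma face_le_trans : transitive face_le.
Proof.
move=> z' z z'' le_zz' /face_leP[le_h' [x [xz' xz'']]].
have [w wb wz] := face_le_below le_zz' xz'; have /face_leP[le_h _] := le_zz'.
apply/face_leP; split; first exact: leq_trans le_h'.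
exists (walk r w x); split=> //; rewrite face_flags_walk //.
by apply: sub_all wb; apply: below_avoiding.
Qed.

HB.instance Definition _ := Order.Le_isPOrder.Build (Order.Disp tt tt) face
  face_le_refl face_le_anti face_le_trans.

Lemma face_leE z z' : (z <= z')%O = face_le z z'.
Proof. by []. Qed.

Fact face_bot z : (face_of ord0 (base_flag M) <= z)%O.
Proof.
have [x xz] := face_flags_neq0 z; apply/face_leP; split=> //.
by exists x; rewrite inE; split=> //; apply: linked_sub (step_connected _ _).
Qed.

Fact face_top z : (z <= face_of ord_max (base_flag M))%O.
Proof.
have [x xz] := face_flags_neq0 z; apply/face_leP; split.
  by rewrite -ltnS ltn_ord.
exists x; split=> //; rewrite inE.
apply: linked_sub (step_connected _ _) => i _.
by rewrite /avoiding /= eqSS ltn_eqF.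
Qed.

HB.instance Definition _ :=
  Order.hasBottom.Build (Order.Disp tt tt) face face_bot.
HB.instance Definition _ :=
  Order.hasTop.Build (Order.Disp tt tt) face face_top.

Lemma face_of_le x : {mono face_of^~ x : h k / (h <= k)%N >-> (h <= k)%O}.
Proof.
move=> h k; rewrite face_leE; apply/face_leP/idP => [[]//|le_hk].
by split=> //; exists x; split; apply/face_flagsP.
Qed.

Definition flag_faces x : {set face} := [set face_of h x | h : 'I_n.+2].

Lemma flag_facesP x z : reflect (x \in face_flags z) (z \in flag_faces x).
Proof.
apply: (iffP imsetP) => [[h _ ->]|/face_flagsP z_x]; first exact/face_flagsP.
by exists (face_height z).
Qed.

Lemma mem_flag_faces h x : face_of h x \in flag_faces x.
Proof. exact: imset_f. Qed.

Lemma card_flag_faces x : #|flag_faces x| = n.+2.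
Proof. by rewrite card_imset ?card_ord //; apply: face_of_inj. Qed.

Lemma chain_flag_faces x : chain (flag_faces x).
Proof.
apply/chainP => _ _ /imsetP[h _ ->] /imsetP[k _ ->].
by rewrite /Order.comparable !face_of_le leq_total.
Qed.

Lemma path_common_flag z (t : seq face) : path <=%O z t ->
  exists x, {in z :: t, forall z', x \in face_flags z'}.
Proof.
elim: t z => [|z' t IHt] z /=.
  by have [x xz] := face_flags_neq0 z; exists x => _ /[1!inE] /eqP->.
case/andP=> le_zz' z't; have [x x_t] := IHt z' z't.
have [w wb wz] := face_le_below le_zz' (x_t z' (mem_head _ _)).
exists (walk r w x) => z'' /[1!inE] /predU1P[->//|tz''].
rewrite face_flags_walk ?x_t //.
apply: sub_all wb; apply: below_avoiding.
have /allP/(_ _ tz'') : all (>= z')%O (z' :: t).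
  by rewrite /= lexx; apply: order_path_min z't; apply: le_trans.
by case/face_leP.
Qed.

Lemma chain_common_flag (A : {set face}) :
  chain A -> exists x, A \subset flag_faces x.
Proof.
move=> /chainP chA; have : sorted <=%O (sort <=%O (enum A)).
  apply: (@sort_sorted_in _ (mem A)) => //.
  by apply/allP => z; rewrite mem_enum.
have memA z : (z \in sort <=%O (enum A)) = (z \in A).
  by rewrite mem_sort mem_enum.
case: (sort _ _) memA => [|z t] memA /= => [_|/path_common_flag[x x_zt]].
  by exists (base_flag M); apply/subsetP => z; rewrite -memA.
by exists x; apply/subsetP => z'; rewrite -memA => /x_zt/flag_facesP.
Qed.

Lemma flag_flag_faces x : flag (flag_faces x).
Proof.
apply/maxsetP; split=> [|B chB sxB]; first exact: chain_flag_faces.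
have [y sBy] := chain_common_flag chB; apply/esym/eqP.
by rewrite eqEcard sxB (leq_trans (subset_leq_card sBy)) // !card_flag_faces.
Qed.

Lemma flag_facesE (A : {set face}) : flag A -> exists x, A = flag_faces x.
Proof.
case/maxsetP => chA maxA; have [x sAx] := chain_common_flag chA; exists x.
by rewrite -(maxA (flag_faces x)) ?chain_flag_faces.
Qed.

Lemma face_flags_size : flags_have_size n face.
Proof. by move=> A /flag_facesE[x ->]; apply: card_flag_faces. Qed.

Lemma height_face z : height z = face_height z.
Proof.
have [x xz] := face_flags_neq0 z.
rewrite (height_flag face_flags_size (flag_flag_faces x)); last first.
  exact/flag_facesP.
move/face_flagsP: xz => {1}->; set h := face_height z.
have lt_h := ltnW (ltn_ord h).
have -> : [set y in flag_faces x | (y < face_of h x)%O] =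
    [set face_of (widen_ord lt_h k) x | k : 'I_h].
  apply/setP => y; rewrite inE.
  apply/andP/imsetP => [[/imsetP[k _ ->]]|[k _ ->]].
    rewrite lt_leAnge !face_of_le -ltnNge => /andP[_ kh].
    by exists (Ordinal kh) => //; congr face_of; apply: val_inj.
  by rewrite mem_flag_faces lt_leAnge !face_of_le -ltnNge /= ltn_ord ltnW.
rewrite card_imset ?card_ord // => k l /face_of_inj /(congr1 val) /= eq_kl.
exact: val_inj.
Qed.

Lemma face_at_flag_faces x h : face_at (flag_faces x) h = face_of h x.
Proof.
have := face_at_height face_flags_size (flag_flag_faces x) (mem_flag_faces h x).
by rewrite height_face.
Qed.

Lemma linked_faces (I : pred 'I_n) x y :
    (forall i, ~~ I i ->
       face_of (step_height i) x = face_of (step_height i) y) ->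
  linked r I x y.
Proof.
move=> eq_faces.
have: forall e : seq 'I_n, {in e, forall i, ~~ I i} ->
    linked r (fun i => i \notin e) x y.
  elim=> [|i e IHe] notIe; first exact: step_connected.
  have /IHe linked_e : {in e, forall j, ~~ I j}.
    by move=> j je; apply: notIe; rewrite inE je orbT.
  have /eqP := eq_faces i (notIe i (mem_head i e)).
  rewrite face_of_eq val_step_height => /step_intersection/(_ linked_e).
  apply: linked_sub => j /= /andP[neq_ij je]; rewrite inE negb_or je andbT.
  by move: neq_ij; rewrite /avoiding eqSS; apply: contraNneq => ->.
move=> /(_ [seq i <- enum 'I_n | ~~ I i]) linked_e.
apply: linked_sub (linked_e _) => i; rewrite mem_filter mem_enum andbT //.
by rewrite negbK.
Qed.

Lemma flag_faces_inj : injective flag_faces.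
Proof.
move=> x y eq_xy; apply: (@linked_pred0 _ _ r pred0) => //.
by apply: linked_faces => i _; rewrite -!face_at_flag_faces eq_xy.
Qed.

Lemma step_changes_face i x :
  face_of (step_height i) (step i x) != face_of (step_height i) x.
Proof.
rewrite eq_sym face_of_eq val_step_height; apply/negP => off_i.
have on_i : linked r (pred1 i) x (step i x).
  by apply: linked_step; rewrite /= eqxx.
have /linked_pred0 eq_x : linked r pred0 x (step i x).
  apply: linked_sub (step_intersection off_i on_i) => j /=.
  rewrite /avoiding eqSS => /andP[neq_ji /eqP eq_ji].
  by rewrite eq_ji eqxx in neq_ji.
by have := colour_step i x; rewrite -eq_x //; case: colour.
Qed.

Lemma flag_faces_adjacent i x :
  i_adjacent i (flag_faces x) (flag_faces (step i x)).
Proof.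
apply/(i_adjacentP face_flags_size) => //.
split=> [||h lt_h]; try exact: flag_flag_faces.
rewrite -[h]/(val (Ordinal lt_h)) !face_at_flag_faces face_of_eq /=.
have [->|neq_h] := eqVneq h i.+1; last first.
  by rewrite linked_step // /avoiding eq_sym.
by rewrite -val_step_height -face_of_eq eq_sym (negbTE (step_changes_face _ _)).
Qed.

Lemma face_connected : strongly_flag_connected n face.
Proof.
move=> _ _ /flag_facesE[x ->] /flag_facesE[y ->].
set D := flag_faces x :&: flag_faces y.
pose I : pred 'I_n :=
  fun i => face_of (step_height i) x != face_of (step_height i) y.
have /linkedP[w Iw <-] : linked r I x y.
  by apply: linked_faces => i; rewrite negbK => /eqP.
have subD u : all I u -> D \subset flag_faces (walk r u x).
  move=> Iu; apply/subsetP => z /setIP[/flag_facesP xz /flag_facesP yz].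
  apply/flag_facesP; rewrite face_flags_walk //; apply: sub_all Iu => i.
  apply: contraNneq => eq_h; have {}eq_h : step_height i = face_height z.
    by apply: val_inj; rewrite /= val_step_height.
  by rewrite eq_h -(face_flagsP _ _ xz) -(face_flagsP _ _ yz).
elim: w Iw => [|i w IHw] /=; first by rewrite connect0.
case/andP=> Ii Iw; apply: connect_trans (IHw Iw) (connect1 _).
rewrite /= subD // (subD (i :: w)) /= ?Ii //.
by apply/existsP; exists i; apply: flag_faces_adjacent.
Qed.

Lemma linked_avoiding_around i x y :
    linked r (predI (avoiding i) (avoiding i.+2)) x y ->
  linked r (far i) x y \/ linked r (far i) (step i x) y.
Proof.
move=> xy; apply: linked_far; [exact: stepK | exact: stepC |].
apply: linked_sub xy => j /=.
rewrite /avoiding /far eqSS => /andP[neq_ji neq_jiS].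
have [/val_inj->|neq_ij] := eqVneq (j : nat) i; first by rewrite /= eqxx.
by apply/orP; right; lia.
Qed.

Lemma between_faces z z' i x :
    face_height z = i :> nat -> face_height z' = i.+2 :> nat ->
    x \in face_flags z -> x \in face_flags z' ->
  [set v | (z < v < z')%O] =
    [set face_of (step_height i) x; face_of (step_height i) (step i x)].
Proof.
move=> hz hz' xz xz'; have hi := val_step_height i.
apply/setP => v; rewrite !inE; apply/idP/orP => [|v_x]; last first.
  have through y : y \in face_flags z -> y \in face_flags z' ->
      (z < face_of (step_height i) y < z')%O.
    move=> /face_flagsP zE /face_flagsP z'E.
    by rewrite zE z'E !lt_leAnge !face_of_le hi hz hz'; lia.
  have mem_step z0 : avoiding (face_height z0) i -> x \in face_flags z0 ->
      step i x \in face_flags z0.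
    by move=> av xz0; rewrite (face_flags_walk _ (w := [:: i])) //= av.
  case: v_x => /eqP->; apply: through => //; apply: mem_step => //.
    by rewrite /avoiding hz; lia.
  by rewrite /avoiding hz'; lia.
case/andP=> zv vz'.
have hv : face_height v = step_height i.
  apply: val_inj; rewrite /= hi -height_face.
  have := height_lt face_flags_size zv; have := height_lt face_flags_size vz'.
  by rewrite !height_face hz hz'; lia.
have [|y yt] := @path_common_flag z [:: v; z']; first by rewrite /= !ltW.
have [yz yv yz'] :
    [/\ y \in face_flags z, y \in face_flags v & y \in face_flags z'].
  by split; apply: yt; rewrite !inE eqxx ?orbT.
have xy : linked r (predI (avoiding i) (avoiding i.+2)) x y.
  by apply: step_intersection; [rewrite -hz | rewrite -hz'];
    rewrite -face_flags_linked.
have sub_far : subpred (far i) (avoiding (step_height i)).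
  by move=> j; rewrite hi /far /avoiding; lia.
by case: (linked_avoiding_around xy) => /(linked_sub sub_far);
  rewrite -face_of_eq => /eqP eq_y; [left | right];
  rewrite eq_y (face_flagsP _ _ yv) hv.
Qed.

Lemma face_diamond : diamond face.
Proof.
move=> z z' zz'; rewrite !height_face => hzz'.
have /face_leP[_ [x [xz xz']]] := ltW zz'.
have lt_n : (face_height z < n)%N.
  by have := ltn_ord (face_height z'); rewrite hzz'.
rewrite (@between_faces z z' (Ordinal lt_n) x) // cards2 eq_sym.
by rewrite step_changes_face.
Qed.

Lemma face_polytope : is_polytope n face.
Proof.
split; [exact: face_flags_size | exact: face_connected | exact: face_diamond].
Qed.

End FacePoset.

Section SndAction.
Variables (gT : finGroupType) (D : {group gT}) (K X : finType).
Variable to : action D X.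

Definition snd_act (z : K * X) g := (z.1, to z.2 g).

Lemma snd_is_action : is_action D snd_act.
Proof.
split=> [g [k x] [l y] [-> /act_inj->] // | z g h Dg Dh].
by rewrite /snd_act actMin.
Qed.

Canonical snd_action := Action snd_is_action.

End SndAction.

Section FaceAction.
Variables (n : nat) (M : maniplex n).
Variables (gT : finGroupType) (D : {group gT}) (to : action D M).
Hypothesis to_equiv : equivariant (@step n M) to.
Local Notation r := (@step n M).
Implicit Types (g : gT) (x : M) (z : face M) (h : 'I_n.+2).

Lemma setact_residue (h : nat) x g : g \in D ->
  residue h (to x g) = [set to y g | y in residue h x].
Proof.
move=> Dg; apply/setP => y; rewrite inE.
apply/idP/imsetP => [xy|[z /[1!inE] xz ->]].
  exists (to y g^-1); last by rewrite actKVin.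
  have Dg' : g^-1 \in D by rewrite groupV.
  by have := act_linked to_equiv Dg' xy; rewrite actKin // inE.
exact: act_linked xz.
Qed.

Fact acts_on_faces : D \subset subact_dom
  [pred z : 'I_n.+2 * {set M} | [exists x, z.2 == residue z.1 x]]
  (snd_action 'I_n.+2 (to^*)%act).
Proof.
apply/subsetP => g Dg; rewrite !inE Dg; apply/subsetP => z; rewrite !inE.
case/existsP=> x /eqP zx; apply/existsP; exists (to x g).
by rewrite /= setact_residue // zx.
Qed.

Definition face_action : action D (face M) :=
  ((snd_action 'I_n.+2 (to^*))^? \ acts_on_faces)%act.

Lemma face_action_of h x g : g \in D ->
  face_action (face_of h x) g = face_of h (to x g).
Proof.
move=> Dg; apply: val_inj; rewrite /= val_subact (subsetP acts_on_faces) //.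
by rewrite /= /snd_act /= setact_residue.
Qed.

Local Notation face_perm := (actperm face_action).

Lemma face_perm_of h x g :
  g \in D -> face_perm g (face_of h x) = face_of h (to x g).
Proof. by move=> Dg; rewrite actpermE face_action_of. Qed.

Lemma face_perm_aut g : g \in D -> face_perm g \in autgrp (face M).
Proof.
have face_perm_le f z z' :
    f \in D -> (z <= z')%O -> (face_perm f z <= face_perm f z')%O.
  move=> Df /face_leP[le_h [x [/face_flagsP-> /face_flagsP->]]].
  by rewrite !face_perm_of // face_of_le.
move=> Dg; rewrite inE; apply/forallP => z; apply/forallP => z'.
apply/eqP; apply/idP/idP; last exact: face_perm_le.
move/(face_perm_le g^-1); rewrite groupV -!permM -actpermM ?groupV // mulgV.
by rewrite (morph1 (actperm_morphism _)) !perm1 => ->.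
Qed.

Definition face_flag x : flag_of (face M) :=
  exist _ (flag_faces x) (flag_flag_faces x).

Lemma face_flag_surj (y : flag_of (face M)) : exists x, y = face_flag x.
Proof. by have [x yx] := flag_facesE (valP y); exists x; apply: val_inj. Qed.

Lemma face_flag_inj : injective face_flag.
Proof. by move=> x y /(congr1 val)/flag_faces_inj. Qed.

Lemma adj_face_flag i x : adj i (face_flag x) = face_flag (step i x).
Proof. by apply: (adj_uniq (face_polytope M)); apply: flag_faces_adjacent. Qed.

Lemma face_perm_flag g x : g \in D ->
  flag_action (face M) (face_flag x) (face_perm g) = face_flag (to x g).
Proof.
move=> Dg; apply: val_inj; rewrite val_flag_action ?face_perm_aut //=.
by rewrite -imset_comp; apply: eq_imset => h; rewrite /= face_perm_of.
Qed.

Definition face_colour (y : flag_of (face M)) :=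
  y \in [set face_flag x | x in [pred x | colour x]].

Lemma face_colour_flag x : face_colour (face_flag x) = colour x.
Proof. by rewrite /face_colour (mem_imset _ _ face_flag_inj). Qed.

Lemma face_colour_adj : alternating (@adj n _ (face M)) face_colour.
Proof.
move=> i y; have [x ->] := face_flag_surj y.
by rewrite adj_face_flag !face_colour_flag colour_step.
Qed.

Hypothesis to_faithful : [faithful D, on [set: M] | to].

Lemma injm_face_perm : 'injm (actperm face_action).
Proof.
apply/subsetP => g /morphpreP[Dg /set1P g1].
have act_free_g := act_free to_equiv (@step_connected n M) to_faithful Dg.
apply/set1P/(act_free_g (base_flag M))/face_flag_inj.
by rewrite -face_perm_flag // [actperm _ _]g1 act1.
Qed.

Variables (s : nat -> gT).
Hypotheses (n_gt0 : (0 < n)%N) (s_rot : rotations_at r to s (base_flag M)).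

Lemma face_perm_flag_rotations :
  flag_rotations n (face_perm \o s) (face_flag (base_flag M)).
Proof.
move=> i j ij; have [sD act_s] := s_rot ij; rewrite /= face_perm_aut //.
by rewrite face_perm_flag // act_s !adj_face_flag.
Qed.

Lemma rotary_polytope_of :
  exists u, polytope_of n s (flag_faces (base_flag M)) u.
Proof.
exists (face_perm \o s); have polyF := face_polytope M.
have isoF := isom_on_gens_inv injm_face_perm (rotations_at_in s_rot).
split=> //; first exact: flag_flag_faces.
have := chiral_or_directly_regular n_gt0 polyF face_colour_adj
  face_perm_flag_rotations; case.
  by case=> chiF rotF autE; left; split; rewrite // autE.
by case=> regF rotF; right.
Qed.

End FaceAction.

(** * The mix of two rotation groups *)

Section CoprimePairs.
Variables (gT hT : finGroupType) (x : gT) (y : hT).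
Hypothesis co_xy : coprime #[x] #[y].

Let pairE : (x, y) = pairg1 hT x * pair1g gT y.
Proof. by congr pair; rewrite ?mulg1 ?mul1g. Qed.

Let pair_commute : commute (pairg1 hT x) (pair1g gT y).
Proof. by congr pair; rewrite /= ?mulg1 ?mul1g. Qed.

Let co_pair : coprime #[pairg1 hT x] #[pair1g gT y].
Proof. by rewrite !order_injm ?injm_pairg1 ?injm_pair1g ?inE. Qed.

Lemma order_pair : #[(x, y)] = (#[x] * #[y])%N.
Proof.
rewrite pairE (orderM pair_commute co_pair).
by rewrite !order_injm ?injm_pairg1 ?injm_pair1g ?inE.
Qed.

Lemma pairg1_in_cycle : (x, 1) \in <[(x, y)]>.
Proof. by rewrite -cycle_subG pairE (cycleMsub pair_commute co_pair). Qed.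

Lemma pair1g_in_cycle : (1, y) \in <[(x, y)]>.
Proof.
rewrite -cycle_subG pairE pair_commute.
by rewrite (cycleMsub (esym pair_commute)) // coprime_sym co_pair.
Qed.

End CoprimePairs.

Lemma expg_pair (gT hT : finGroupType) (x : gT) (y : hT) m :
  (x, y) ^+ m = (x ^+ m, y ^+ m).
Proof. by elim: m => // m IHm; rewrite !expgS IHm. Qed.

Lemma mix_setX n (gT hT : finGroupType) (s : nat -> gT) (t : nat -> hT) :
    (forall j, (0 < j < n)%N -> coprime #[s j] #[t j]) ->
  mix n s t = setX (rot_group n s) (rot_group n t).
Proof.
move=> co_st; apply/eqP; rewrite eqEsubset; apply/andP; split.
  apply: (@rot_group_sub _ _ _ (setX_group _ _)) => j jn.
  by rewrite inE !mem_rot_gen.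
have cycle_sub_mix j : (0 < j < n)%N -> <[(s j, t j)]> \subset mix n s t.
  by move=> jn; rewrite cycle_subG (mem_rot_gen (mix_gen s t)).
rewrite -setX_prod -morphim_pairg1 -morphim_pair1g.
have morphim_gens (aT bT : finGroupType) (f : {morphism [set: aT] >-> bT}) v :
    f @* rot_group n v = rot_group n (f \o v).
  by apply: morphim_rot_group => j _; rewrite inE.
rewrite !morphim_gens /=.
rewrite mul_subG //; apply: rot_group_sub => j jn;
  apply: (subsetP (cycle_sub_mix j jn)).
  exact: pairg1_in_cycle (co_st j jn).
exact: pair1g_in_cycle (co_st j jn).
Qed.

Section ProductAction.
Variables (gT hT : finGroupType) (D : {group gT}) (E : {group hT}).
Variables (X Y : finType) (toX : action D X) (toY : action E Y).

Definition prod_act (xy : X * Y) (g : gT * hT) := (toX xy.1 g.1, toY xy.2 g.2).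

Lemma prod_is_action : is_action (setX D E) prod_act.
Proof.
split=> [g [x y] [u v] [/act_inj-> /act_inj->] // | xy [g1 g2] [h1 h2]].
case/setXP=> Dg Eg /setXP[Dh Eh].
by rewrite /prod_act /= !actMin.
Qed.

Canonical prod_action := Action prod_is_action.

End ProductAction.

Section MixAction.
Variables (n : nat) (M N : maniplex n) (gT hT : finGroupType).
Variables (D : {group gT}) (E : {group hT}).
Variables (toM : action D M) (toN : action E N).
Hypothesis equivM : equivariant (@step n M) toM.
Hypothesis equivN : equivariant (@step n N) toN.
Hypothesis faithM : [faithful D, on [set: M] | toM].
Hypothesis faithN : [faithful E, on [set: N] | toN].
Variables (s : nat -> gT) (t : nat -> hT).
Hypothesis s_rot : rotations_at (@step n M) toM s (base_flag M).
Hypothesis t_rot : rotations_at (@step n N) toN t (base_flag N).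
Hypothesis co_st : forall j, (0 < j < n)%N -> coprime #[s j] #[t j].
Hypothesis same_base_colour : colour (base_flag M) = colour (base_flag N).

Lemma coprime_independent_rotations :
  independent_rotations (@step n M) (@step n N).
Proof.
move=> i j ij; have jn : (0 < j < n)%N by have := ltn_ord j; lia.
have /cycleP[m] := pair1g_in_cycle (co_st jn).
rewrite expg_pair => -[sm tm]; exists m; split.
  exact: (eq_iter_rotation equivM s_rot faithM (k := 0) ij).
exact: (eq_iter_rotation equivN t_rot faithN (k := 1) ij).
Qed.

Local Notation MN :=
  (mix_maniplex coprime_independent_rotations same_base_colour).

Local Notation DE :=
  (subact_dom_group [pred xy : M * N | colour xy.1 == colour xy.2]
     (prod_action toM toN)).

Definition mix_action : action DE MN :=
  ((prod_action toM toN)^? : action _ (mix_flag M N))%act.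

Lemma val_mix_action xy g : g \in DE ->
  val (mix_action xy g) = (toM (val xy).1 g.1, toN (val xy).2 g.2).
Proof. by move=> DEg; rewrite val_subact DEg. Qed.

Lemma mix_action_dom g : g \in DE -> g.1 \in D /\ g.2 \in E.
Proof. by case: g => g h /setIP[/setXP]. Qed.

Lemma mix_action_equivariant : equivariant (@step n MN) mix_action.
Proof.
move=> g i xy DEg; have [Dg Eg] := mix_action_dom DEg.
apply: val_inj; rewrite val_mix_action //= val_mix_action //=.
by rewrite equivM // equivN.
Qed.

Lemma mix_action_faithful : [faithful DE, on [set: MN] | mix_action].
Proof.
apply/subsetP => g /setIP[DEg /setIP[_ fix_g]]; apply/set1P.
have [Dg Eg] := mix_action_dom DEg.
move: fix_g; rewrite inE => /subsetP/(_ (base_flag MN) (in_setT _)).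
rewrite inE => /eqP/(congr1 val); rewrite val_mix_action // => -[g1 g2].
rewrite (surjective_pairing g).
rewrite (act_free equivM (@step_connected n M) faithM Dg g1).
by rewrite (act_free equivN (@step_connected n N) faithN Eg g2).
Qed.

Lemma mix_gen_rotations_at :
  rotations_at (@step n MN) mix_action (mix_gen s t) (base_flag MN).
Proof.
move=> i j ij; have [[Ds act_s] [Et act_t]] := (s_rot ij, t_rot ij).
have DEst : mix_gen s t j \in DE.
  rewrite !inE Ds Et; apply/subsetP => -[x y]; rewrite !inE /=.
  rewrite (colour_act_rotation equivM s_rot _ ij).
  by rewrite (colour_act_rotation equivN t_rot _ ij).
split=> //; apply: val_inj; rewrite val_mix_action //=.
by rewrite act_s act_t.
Qed.

Lemma mix_intersection_property : intersection_property n (mix_gen s t).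
Proof.
exact: (rotary_intersection_property mix_action_equivariant mix_gen_rotations_at
  mix_action_faithful).
Qed.

Lemma mix_polytope_of : (0 < n)%N ->
  exists u, polytope_of n (mix_gen s t) (flag_faces (base_flag MN)) u.
Proof.
move=> n_gt0.
exact: (rotary_polytope_of mix_action_equivariant mix_action_faithful n_gt0
  mix_gen_rotations_at).
Qed.

End MixAction.

(** * Total chirality *)

(* |H / N| = |K|^2 divides |K| |L|. *)
Lemma no_square_quotient (gT hT : finGroupType)
    (K : {group gT}) (L : {group hT}) :
  ~~ (#|K| %| #|L|)%N -> no_subgroup_with_quotient (setX K L) (setX K K).
Proof.
move=> ndiv H N sHG nNH /card_isog; rewrite card_quotient ?normal_norm //.
rewrite cardsX => card_HN; case/negP: ndiv.
rewrite -(dvdn_pmul2l (cardG_gt0 K)) -card_HN -cardsX.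
apply: dvdn_trans (dvdn_indexg _ _) _.
exact: (@cardSg _ (setX_group K L) H).
Qed.

Lemma no_subgroup_with_quotient_morphim (gT hT kT : finGroupType)
    (G : {set gT}) (H : {group hT}) (K : {set kT})
    (f : {morphism H >-> gT}) (chi : {morphism H >-> kT}) :
    no_subgroup_with_quotient G K -> 'injm f -> f @* H \subset G ->
  chi @* H <> K.
Proof.
move=> no_quo injf sfG chiH; rewrite -chiH in no_quo.
case: (no_quo (f @* H)%G (f @* 'ker chi)%G) => //.
  exact/morphim_normal/ker_normal.
apply: isog_trans (first_isog chi); rewrite isog_sym.
have kerN := ker_normal chi.
apply/isogP; exists (quotm_morphism f kerN); first exact: injm_quotm.
exact: morphim_quotm.
Qed.

Definition satisfies_cox_relations n (gT : finGroupType) (rho : nat -> gT) :=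
  forall w v : seq 'I_n, cox_eq w v ->
    \prod_(i <- w) rho i = \prod_(i <- v) rho i.

Section CoxeterProduct.
Variables (n : nat) (gT : finGroupType) (rho : nat -> gT).
Hypothesis rho_cox : satisfies_cox_relations n rho.

Definition cox_prod (x : cox n) := \prod_(i <- generic_quotient.repr x) rho i.

Lemma cox_prod_word (w : seq 'I_n) :
  cox_prod (cox_word w) = \prod_(i <- w) rho i.
Proof. exact/rho_cox/cox_repr. Qed.

Lemma cox_prodM x y : cox_prod (x * y) = cox_prod x * cox_prod y.
Proof. by rewrite [x * y]/(cox_mul x y) cox_prod_word big_cat. Qed.

Lemma cox_prod1 : cox_prod 1 = 1.
Proof. by apply: (@mulgI _ (cox_prod 1)); rewrite -cox_prodM !mulg1. Qed.

Lemma cox_prodV x : cox_prod x^-1 = (cox_prod x)^-1.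
Proof.
by apply: (@mulgI _ (cox_prod x)); rewrite -cox_prodM !mulgV cox_prod1.
Qed.

Lemma cox_prod_r i : (i < n)%N -> cox_prod (cox_r n i) = rho i.
Proof. by move=> lt_in; rewrite /cox_r insubT cox_prod_word big_seq1. Qed.

End CoxeterProduct.

(* Composing an epimorphism f of a rotation group onto Gamma(P) with the
   conjugation by rho 0 yields its mirror image; total chirality makes the two
   independent. *)
Section MirrorPair.
Variables (n : nat) (gT hT : finGroupType).
Variables (rho u : nat -> hT) (s : nat -> gT).
Hypothesis n_gt0 : (0 < n)%N.
Hypothesis rho_cox : satisfies_cox_relations n rho.
Hypothesis u_rho : forall j, (0 < j < n)%N -> u j = rho j.-1 * rho j.
Hypothesis rho0_norm : rho 0 \in 'N(rot_group n u).
Variable f : {morphism rot_group n u >-> gT}.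
Hypothesis f_u : forall j, (0 < j < n)%N -> f (u j) = s j.
Local Notation H := (rot_group n u).

Definition mirror_pair (g : hT) := (f g, f (g ^ rho 0)).

Lemma mirror_pairM : {in H &, {morph mirror_pair : g h / g * h}}.
Proof.
move=> g h Hg Hh; rewrite /mirror_pair conjMg morphM //; congr pair.
by rewrite morphM ?memJ_norm.
Qed.

Canonical mirror_pair_morphism := Morphism mirror_pairM.

Lemma morphim_rotations : f @* H = rot_group n s.
Proof. by apply: morphim_rot_group => j jn; rewrite mem_rot_gen ?f_u. Qed.

Lemma rho0_invol : rho 0 * rho 0 = 1.
Proof.
pose i0 := Ordinal n_gt0; have := rho_cox (cox_sq [::] [::] i0).
by rewrite /= !big_cons big_nil mulg1.
Qed.

Variable phi : cox n -> gT.
Hypothesis phiM : forall x y,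
  cox_plus x -> cox_plus y -> phi (x * y) = phi x * phi y.
Hypothesis phi_s : forall j, (0 < j < n)%N -> phi (cox_s n j) = s j.

Lemma cox_plus_phi1 : phi 1 = 1.
Proof.
by apply: (@mulgI _ (phi 1)); rewrite -phiM ?mulg1 //; apply: gen_by_1.
Qed.

Lemma cox_plus_phi w : cox_plus w ->
  cox_prod rho w \in H /\ phi w = f (cox_prod rho w).
Proof.
elim=> [_ [j jn ->]||x y px [Hx xE] py [Hy yE]|x px [Hx xE]].
- have -> : cox_prod rho (cox_s n j) = u j.
    by rewrite cox_prodM // !cox_prod_r ?u_rho //; lia.
  by rewrite mem_rot_gen // phi_s // f_u.
- by rewrite cox_prod1 // group1 cox_plus_phi1 morph1.
- by rewrite cox_prodM // groupM // phiM // xE yE morphM.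
rewrite cox_prodV // groupV Hx morphV //; split=> //.
apply: (@mulgI _ (phi x)); rewrite -phiM //; last exact: gen_by_V.
by rewrite !mulgV cox_plus_phi1 xE mulgV.
Qed.

Lemma cox_plus_phi_onto :
  {in rot_group n s, forall a, exists2 w, cox_plus w & phi w = a}.
Proof.
apply: rot_group_ind => [|j _ jn [w pw <-]].
  by exists 1; [apply: gen_by_1 | apply: cox_plus_phi1].
have ps : cox_plus (cox_s n j) by apply: gen_by_in; exists j.
by exists (cox_s n j * w); [apply: gen_by_M | rewrite phiM // phi_s].
Qed.

Hypothesis phi_total : let K w := cox_plus w /\ phi w = 1 in
  forall w : cox n, cox_plus w <->
    exists m m', [/\ K m, K m' & w = m * (cox_r n 0 * m' * (cox_r n 0)^-1)].

Lemma mirror_pair_factors a : a \in rot_group n s ->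
  (a, 1) \in mirror_pair @* H /\ (1, a) \in mirror_pair @* H.
Proof.
case/cox_plus_phi_onto => w pw wa.
have [m [m' [[pm m1] [pm' m'1] wE]]] := (phi_total w).1 pw.
set v := cox_r n 0 * m' * (cox_r n 0)^-1 in wE.
have pv : cox_plus v.
  by rewrite -(mulKg m v) -wE; apply: gen_by_M => //; apply: gen_by_V.
have va : phi v = a by rewrite -wa wE phiM // m1 mul1g.
have [[Hv vE] [Hm' m'E]] := (cox_plus_phi pv, cox_plus_phi pm').
have conj_v : cox_prod rho v ^ rho 0 = cox_prod rho m'.
  rewrite /v !cox_prodM // cox_prodV // cox_prod_r // /conjg.
  by rewrite !mulgA mulVg mul1g mulgKV.
have conj_m' : cox_prod rho m' ^ rho 0 = cox_prod rho v.
  by rewrite -conj_v -conjgM rho0_invol conjg1.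
split; apply/morphimP.
  by exists (cox_prod rho v); rewrite //= /mirror_pair conj_v -vE -m'E va m'1.
by exists (cox_prod rho m'); rewrite //= /mirror_pair conj_m' -vE -m'E va m'1.
Qed.

Lemma mirror_pair_onto :
  mirror_pair @* H = setX (rot_group n s) (rot_group n s).
Proof.
apply/eqP; rewrite eqEsubset; apply/andP; split.
  apply/subsetP => _ /morphimP[g _ Hg ->]; rewrite inE /= -morphim_rotations.
  by rewrite !mem_morphim // memJ_norm.
apply/subsetP => -[a b].
case/setXP=> /mirror_pair_factors[a1 _] /mirror_pair_factors[_ b1].
suff -> : (a, b) = (a, 1) * (1, b) by apply: groupM.
by congr pair; rewrite /= ?mulg1 ?mul1g.
Qed.

End MirrorPair.

Lemma totally_chiral_mirror n d (R : finTBPOrderType d) (x0 : flag_of R)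
    (u : nat -> {perm R}) (gT : finGroupType) (s : nat -> gT)
    (f : {morphism rot_group n u >-> gT}) :
    (0 < n)%N -> is_polytope n R -> directly_regular n R ->
    regular_rotations n (val x0) u ->
    (forall j, (0 < j < n)%N -> f (u j) = s j) -> totally_chiral n s ->
  exists chi : {morphism rot_group n u >-> gT * gT},
    chi @* rot_group n u = setX (rot_group n s) (rot_group n s).
Proof.
move=> n_gt0 polyR regR rot_u f_u [phi [phiM phi_s phi_total]].
have [c c_alt] := directly_regular_colour polyR regR.
have u_rot := regular_flag_rotations polyR rot_u.
have [rho refl_rho u_rho] := rot_u.
have rho_cox : satisfies_cox_relations n rho.
  move=> w v eq_wv; apply: (prod_reflections_eq polyR refl_rho).
  exact: (walk_cox_eq (adjK polyR) (adjC polyR)).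
have rho0_norm : rho 0 \in 'N(rot_group n u).
  apply: subsetP (normal_norm (rot_group_normal_colour polyR c_alt u_rot)) _ _.
  by have [] := reflectionP polyR refl_rho (Ordinal n_gt0).
exists (mirror_pair_morphism rho0_norm f).
exact: (mirror_pair_onto n_gt0 rho_cox u_rho rho0_norm f_u
  phiM phi_s phi_total).
Qed.

(** * The mix of a chiral and a directly regular polytope *)

Lemma mix_polytopes n dP (P : finTBPOrderType dP) dQ (Q : finTBPOrderType dQ)
    (s : nat -> {perm P}) (t : nat -> {perm Q})
    (x0 : flag_of P) (y0 : flag_of Q)
    (cP : flag_of P -> bool) (cQ : flag_of Q -> bool) :
    (0 < n)%N -> is_polytope n P -> is_polytope n Q ->
    alternating (@adj n dP P) cP -> alternating (@adj n dQ Q) cQ ->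
    flag_rotations n s x0 -> flag_rotations n t y0 ->
    (forall j, (0 < j < n)%N -> coprime #[s j] #[t j]) ->
  intersection_property n (mix_gen s t) /\
  exists (dR : Order.disp_t) (R : finTBPOrderType dR)
         (Omega : {set R}) (u : nat -> {perm R}),
    polytope_of n (mix_gen s t) Omega u.
Proof.
move=> n_gt0 polyP polyQ cP_alt cQ_alt s_rot t_rot co_st.
pose M := flag_maniplex polyP (alternating_eqb (cP x0) cP_alt) x0.
pose N := flag_maniplex polyQ (alternating_eqb (cQ y0) cQ_alt) y0.
have same_colour : colour (base_flag M) = colour (base_flag N).
  by rewrite /= !eqxx.
have equivP : equivariant (@step n M) _ := flag_action_adj polyP.
have equivQ : equivariant (@step n N) _ := flag_action_adj polyQ.
have faithP := flag_action_faithful polyP.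
have faithQ := flag_action_faithful polyQ.
split; first exact: (mix_intersection_property equivP equivQ faithP faithQ
  s_rot t_rot co_st same_colour).
do 3!eexists; exact: (mix_polytope_of equivP equivQ faithP faithQ
  s_rot t_rot co_st same_colour n_gt0).
Qed.

Lemma order_polytope_of n (gT : finGroupType) (s : nat -> gT)
    d (R : finTBPOrderType d) (Omega : {set R}) (u : nat -> {perm R}) j :
  polytope_of n s Omega u -> (0 < j < n)%N -> #[u j] = #[s j].
Proof.
move=> [_ _ [[_ rot_u [f /isom_inj injf f_u]]|[_ _ [f /isom_inj injf f_u]]]] jn;
  rewrite -f_u // order_injm //; last exact: mem_rot_gen.
by have [] := rot_u j jn.
Qed.

Lemma chiral_mix n (gT hT : finGroupType) (s : nat -> gT) (t : nat -> hT)
    d (R : finTBPOrderType d) (Omega : {set R}) (u : nat -> {perm R}) :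
    (0 < n)%N -> polytope_of n (mix_gen s t) Omega u -> totally_chiral n s ->
    no_subgroup_with_quotient (mix n s t)
      (setX (rot_group n s) (rot_group n s)) ->
  chiral n R.
Proof.
move=> n_gt0 [polyR flOmega [[]//|[regR rot_u [f isom_f f_u]]]] tot_s no_quo.
have fstM : {in rot_group n u &, {morph (fst \o f) : g h / g * h}}.
  by move=> g h ug uh; rewrite /= morphM.
have fst_u j : (0 < j < n)%N -> Morphism fstM (u j) = s j.
  by move=> jn; rewrite /= f_u.
have [chi chi_u] := totally_chiral_mirror (x0 := exist _ Omega flOmega)
  n_gt0 polyR regR rot_u fst_u tot_s.
case: (no_subgroup_with_quotient_morphim no_quo (isom_inj isom_f) _ chi_u).
by rewrite (isom_im isom_f).
Qed.

Theorem theorem9p1 (n : nat) (hn : (3 <= n)%N)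
  (dP : Order.disp_t) (P : finTBPOrderType dP)
  (Phi : {set P}) (s : nat -> {perm P}) (p : nat -> nat)
  (dQ : Order.disp_t) (Q : finTBPOrderType dQ)
  (Psi : {set Q}) (t : nat -> {perm Q}) (q : nat -> nat)
  (hP : is_polytope n P) (chiP : chiral n P)
  (hPhi : flag Phi) (hs : chiral_rotations n Phi s)
  (hp : forall j, (0 < j < n)%N -> #[s j] = p j)
  (hQ : is_polytope n Q) (regQ : directly_regular n Q)
  (hPsi : flag Psi) (ht : regular_rotations n Psi t)
  (hq : forall j, (0 < j < n)%N -> #[t j] = q j)
  (hpq : forall j, (0 < j < n)%N -> coprime (p j) (q j)) :
  let G := setX (autgrp P) (rot_group n t) in
  [/\ intersection_property n (mix_gen s t),
      mix n s t = G,
      exists (dR : Order.disp_t) (R : finTBPOrderType dR)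
             (Omega : {set R}) (u : nat -> {perm R}),
        polytope_of n (mix_gen s t) Omega u,
      ~~ (#|autgrp P| %| #|rot_group n t|)%N ->
        no_subgroup_with_quotient G (setX (autgrp P) (autgrp P))
    & forall (dR : Order.disp_t) (R : finTBPOrderType dR)
             (Omega : {set R}) (u : nat -> {perm R}),
        polytope_of n (mix_gen s t) Omega u ->
        (forall j, (0 < j < n)%N -> #[u j] = (p j * q j)%N) /\
        (totally_chiral n s ->
         no_subgroup_with_quotient G (setX (autgrp P) (autgrp P)) ->
         chiral n R)].
Proof.
have n_gt0 : (0 < n)%N by apply: leq_trans hn.
pose x0 : flag_of P := exist _ Phi hPhi.
pose y0 : flag_of Q := exist _ Psi hPsi.
have s_rot : flag_rotations n s x0 := (chiral_rotationsP hP s x0).1 hs.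
have t_rot : flag_rotations n t y0 :=
  regular_flag_rotations hQ (x := y0) ht.
have [cQ cQ_alt] := directly_regular_colour hQ regQ.
have co_st j : (0 < j < n)%N -> coprime #[s j] #[t j].
  by move=> jn; rewrite hp // hq // hpq.
have [mix_int mix_poly] := mix_polytopes n_gt0 hP hQ
  (chiral_colour hP x0 chiP) cQ_alt s_rot t_rot co_st.
have autE : autgrp P = rot_group n s := chiral_autgrp hP chiP s_rot.
have mixE : mix n s t = setX (autgrp P) (rot_group n t).
  by rewrite mix_setX ?autE.
split=> //.
  exact: (@no_square_quotient _ _ (autgrp_group P) (rot_group_group n t)).
move=> dR R Omega u polyR; split=> [j jn | tot_s no_quo].
  by rewrite (order_polytope_of polyR jn) order_pair ?co_st // hp // hq.
by apply: (chiral_mix n_gt0 polyR tot_s); rewrite mixE -autE.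
Qed.
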